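(* Let $G$ be a countably infinite discrete amenable group that has a local tiling algorithm, and let $G\curvearrowright X$ be a free action by homeomorphisms on a compact metrizable space. If the action has property FCSB, then it has URPC (the Uniform Rokhlin Property and comparison).
   Context: Invariance: a finite set $S\subset G$ is $(K,\varepsilon)$-invariant (for finite $K\subset G$, $\varepsilon>0$) if $\left|\bigcap_{g\in K}gS\right|>(1-\varepsilon)|S|$. Local functions: for a set $Q$, a subset $\mathcal{F}\subset Q^G$ is right-invariant if for all $x\in\mathcal{F}$ and $g\in G$ the function $h\mapsto x_{hg}$ belongs to $\mathcal{F}$. For finite $W\subset G$ let $\mathcal{F}|_W\subset Q^W$ be the set of restrictions. For a right-invariant $\mathcal{F}$, a map $\Phi:\mathcal{F}\to R^G$, $x\mapsto\Phi_x$, is local if there are a finite $W\subset G$ and a map $\phi:\mathcal{F}|_W\to R$ with $\Phi_x(g)=\phi\left((x_{hg})_{h\in W}\right)$ for all $x\in\mathcal{F}$, $g\in G$. Colorings: for a finite symmetric set $F\subset G$ containing $e$, let $n=3^{|F|}$ and $\mathcal{C}_F=\{(x_g)_{g\in G}\in\{1,\dots,n\}^G: x_h\ne x_{gh}\text{ for all }g\in F\setminus\{e\},\ h\in G\}$. Exact tilings: for finite $D\subset G$ let $2^D$ be the set of subsets of $D$ and $\star$ an extra symbol. A map $S:G\to2^D\sqcup\{\star\}$ is an exact tiling of $G$ if, with $C(S)=\{g\in G:S(g)\ne\star\}$, the sets $S(g)g$, $g\in C(S)$, are pairwise disjoint and $G=\bigsqcup_{g\in C(S)}S(g)g$. It is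 $(K,\varepsilon)$-invariant if $S(g)$ is a $(K,\varepsilon)$-invariant set for every $g\in C(S)$. $G$ has a local tiling algorithm if for every finite $K\subset G$ and $\varepsilon>0$ there are finite symmetric sets $F,D\subset G$, with $e\in F$, and a local function $S:\mathcal{C}_F\to\left(2^D\sqcup\{\star\}\right)^G$ such that $S_x$ is a $(K,\varepsilon)$-invariant exact tiling of $G$ for every $x\in\mathcal{C}_F$. Markers: $U\subset X$ is $L$-free (for finite $L\subset G$) if the sets $gU$, $g\in L$, are pairwise disjoint. A marker set is an open $U\subset X$ with $\bigcup_{g\in G}gU=X$. The marker property: for every finite $L\subset G$ there is an $L$-free marker set. Subequivalence: for closed sets $A_1,\dots,A_p\subset X$ and an open set $B\subset X$, $\sum_i[A_i]\prec B$ means that for each $i$ there is a finite open cover $\{U_{i,k}\}_k$ of $A_i$ and elements $g_{i,k}\in G$ such that all the sets $g_{i,k}U_{i,k}$ (over all pairs $(i,k)$) are pairwise disjoint subsets of $B$. Property FCSB: the action has the marker property, and for every finite $F\subset G$ and every marker set $V$ there is a finite collection $\{U_i\}_{i=1}^n$ of $F$-free open sets with $\sum_{i=1}^n[\partial U_i]+\left[X\setminus\bigcup_{i=1}^nU_i\right]\prec V$. URPC: for $A\subset X$ let $\overline{D}(A)=\inf_F\sup_{x\in X}\frac{|A\cap Fx|}{|F|}$ over nonempty finite $F\subset G$. A castle is a finite collection of pairs $(S_i,V_i)$ with $S_i\subset G$ finite (shapes), $V_i\subset X$ open and $S_i$-free, and with the sets $S_iV_i=\bigcup_{g\in S_i}gV_i$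 pairwise disjoint. URP: for every finite $K\subset G$ and $\varepsilon>0$ there is a castle with $(K,\varepsilon)$-invariant shapes and $\overline{D}\left(X\setminus\bigsqcup_iS_iV_i\right)<\varepsilon$. Comparison: $[A]\prec B$ whenever $A$ is closed, $B$ is open and $\mu(A)<\mu(B)$ for every $G$-invariant Borel probability measure $\mu$ on $X$. URPC means URP together with comparison. *)

(* Defs.v *)
From HB Require Import structures.
From mathcomp Require Import all_boot all_order all_algebra finmap.
From mathcomp Require Import all_classical all_reals all_analysis.

Set Implicit Arguments.
Unset Strict Implicit.
Unset Printing Implicit Defensive.

Import Order.TTheory GRing.Theory Num.Theory.

Local Open Scope classical_set_scope.
Local Open Scope ring_scope.

(* The cardinality is the extended-real-valued one: for [K = fset0] the
   intersection is the whole group, and an infinite cardinality is [+oo]. *)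
Definition invariant_fset (R : realType) (G : groupType) (K : {fset G})
    (eps : R) (S : {fset G}) : Prop :=
  (((1 - eps) * #|` S|%:R)%:E <
     counting (\bigcap_(g in [set` K]) ((fun h => (g * h)%g) @` [set` S])))%E.

(* Foelner's condition. *)
Definition amenable (R : realType) (G : groupType) : Prop :=
  forall (K : {fset G}) (eps : R), 0 < eps ->
    exists2 S : {fset G}, S != fset0 & invariant_fset K eps S.

Definition right_invariant (G : groupType) (Q : Type) (F : set (G -> Q)) : Prop :=
  forall (x : G -> Q) (g : G), F x -> F (fun h => x (h * g)%g).

(* [Phi] and [phi] are total: only the values of [Phi] on [F], and of [phi] on
   the restrictions to [W] of elements of [F], matter.  For nonempty [T] every
   map defined on [F], resp. on the set of restrictions, is of this form. *)
Definition local_on (G : groupType) (Q T : Type) (F : set (G -> Q))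
    (Phi : (G -> Q) -> G -> T) : Prop :=
  exists (W : {fset G}) (phi : (W -> Q) -> T),
    forall (x : G -> Q) (g : G), F x ->
      Phi x g = phi (fun h : W => x (val h * g)%g).

Definition symmetric_fset (G : groupType) (F : {fset G}) : Prop :=
  forall g, g \in F -> (g^-1)%g \in F.

(* The colors [0, ..., n - 1] stand for [1, ..., n]. *)
Definition colorings (G : groupType) (F : {fset G}) :
    set (G -> 'I_(3 ^ #|` F|)) :=
  [set x | forall g h : G, g \in F -> g != 1%g -> x h != x (g * h)%g].
Arguments colorings {G} F.

Lemma colorings_right_invariant (G : groupType) (F : {fset G}) :
  right_invariant (colorings F).
Proof. by move=> x g Fx k h kF k1; rewrite -mulgA; exact: Fx. Qed.

(* [fpowerset D] is the set of subsets of [D]; [None] is the extra symbol. *)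
Section tilings.
Context (G : groupType) (D : {fset G}) (S : G -> option (fpowerset D)).

Definition tiling_centers : set G := [set g | S g <> None].

Definition tiling_shape (g : G) : {fset G} :=
  if S g is Some A then val A else fset0.

Definition exact_tiling : Prop :=
  let tile g := (fun s => (s * g)%g) @` [set` tiling_shape g] in
  trivIset tiling_centers tile /\ \bigcup_(g in tiling_centers) tile g = setT.

Definition invariant_tiling (R : realType) (K : {fset G}) (eps : R) : Prop :=
  forall g, tiling_centers g -> invariant_fset K eps (tiling_shape g).

End tilings.

Definition has_local_tiling_algorithm (R : realType) (G : groupType) : Prop :=
  forall (K : {fset G}) (eps : R), 0 < eps ->
    exists F D : {fset G},
      [/\ symmetric_fset F, symmetric_fset D, (1%g : G) \in F &
        exists2 S : (G -> 'I_(3 ^ #|` F|)) -> G -> option (fpowerset D),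
          local_on (colorings F) S &
          forall x, colorings F x ->
            exact_tiling (S x) /\ invariant_tiling (S x) K eps].

Definition metrizable (R : realType) (X : topologicalType) : Prop :=
  exists d : X -> X -> R,
    [/\ forall x y, d x y = 0 <-> x = y,
        forall x y, d x y = d y x,
        forall x y z, d x z <= d x y + d y z &
        forall (x : X) (A : set X),
          nbhs x A <-> exists2 e : R, 0 < e & [set y | d x y < e] `<=` A].

Definition boundary (X : topologicalType) (U : set X) : set X :=
  closure U `\` interior U.

(* Each [act g] is then a homeomorphism, with inverse [act g^-1]. *)
Definition action_by_homeo (G : groupType) (X : topologicalType)
    (act : G -> X -> X) : Prop :=
  [/\ forall x, act 1%g x = x,
      forall g h x, act (g * h)%g x = act g (act h x) &
      forall g, continuous (act g)].

Definition free_action (G : groupType) (X : topologicalType)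
    (act : G -> X -> X) : Prop :=
  forall g x, act g x = x -> g = 1%g.

(* Borel probability measures.  Measurable types are pointed in the library, so
   a base point [x0] is part of the Borel space; the sigma-algebra does not
   depend on it, and an empty space carries no probability measure. *)
Definition pointed_at (X : topologicalType) (x0 : X) : Type := X.

HB.instance Definition _ (X : topologicalType) (x0 : X) :=
  Choice.on (pointed_at x0).
HB.instance Definition _ (X : topologicalType) (x0 : X) :=
  isPointed.Build (pointed_at x0) x0.

Definition borel_space (X : topologicalType) (x0 : X) : measurableType _ :=
  g_sigma_algebraType (@open X : set (set (pointed_at x0))).

Section dynamics.
Context (R : realType) (G : groupType) (X : topologicalType).
Variable act : G -> X -> X.

Definition free_set (L : {fset G}) (U : set X) : Prop :=
  trivIset [set` L] (fun g => act g @` U).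

Definition marker_set (U : set X) : Prop :=
  open U /\ \bigcup_(g in [set: G]) (act g @` U) = setT.

Definition marker_property : Prop :=
  forall L : {fset G}, exists2 U, free_set L U & marker_set U.

(* The family [A] is indexed by a finite type; the cover of [A i] consists of
   the sets [U i k] for [k < m i]. *)
Definition subequivalent (I : finType) (A : I -> set X) (B : set X) : Prop :=
  exists (m : I -> nat) (U : I -> nat -> set X) (g : I -> nat -> G),
    [/\ forall i k, (k < m i)%N -> open (U i k),
        forall i, A i `<=` \bigcup_(k in `I_(m i)) U i k,
        forall i k, (k < m i)%N -> act (g i k) @` U i k `<=` B &
        trivIset [set ik : I * nat | (ik.2 < m ik.1)%N]
          (fun ik => act (g ik.1 ik.2) @` U ik.1 ik.2)].

Definition FCSB : Prop :=
  marker_property /\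
  forall (F : {fset G}) (V : set X), marker_set V ->
    exists (n : nat) (U : 'I_n -> set X),
      (forall i, open (U i) /\ free_set F (U i)) /\
      subequivalent
        (fun j : option 'I_n =>
           if j is Some i then boundary (U i)
           else ~` \bigcup_(i in [set: 'I_n]) U i)
        V.

Definition upper_density (A : set X) : \bar R :=
  ereal_inf [set ereal_sup [set
      ((#|` fset_set (A `&` (act^~ x @` [set` F])) |)%:R / (#|` F|)%:R)%:E
      | x in [set: X]]
    | F in [set F : {fset G} | F != fset0]].

Definition tower (S : {fset G}) (V : set X) : set X :=
  \bigcup_(g in [set` S]) (act g @` V).

Definition castle (n : nat) (S : 'I_n -> {fset G}) (V : 'I_n -> set X) : Prop :=
  (forall i, open (V i) /\ free_set (S i) (V i)) /\
  trivIset setT (fun i => tower (S i) (V i)).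

Definition URP : Prop :=
  forall (K : {fset G}) (eps : R), 0 < eps ->
    exists (n : nat) (S : 'I_n -> {fset G}) (V : 'I_n -> set X),
      [/\ castle S V,
          forall i, invariant_fset K eps (S i) &
          (upper_density (~` \bigcup_(i in [set: 'I_n]) tower (S i) (V i))
             < eps%:E)%E].

Definition invariant_measure (x0 : X) (mu : probability (borel_space x0) R) :
    Prop :=
  forall (g : G) (A : set (borel_space x0)),
    measurable A -> mu (act g @` A) = mu A.

Definition comparison : Prop :=
  forall A B : set X, closed A -> open B ->
    (forall (x0 : X) (mu : probability (borel_space x0) R),
       invariant_measure mu -> (mu A < mu B)%E) ->
    subequivalent (fun _ : unit => A) B.

Definition URPC : Prop := URP /\ comparison.

End dynamics.

Arguments URPC R {G X} act.

(* Main.v *)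
(* For the Rokhlin property, one colors [X] properly by [3 ^ #|F|] colors and lets
   the local tiling algorithm run on the colorings of the orbits.  The tiles make up
   the towers of a castle, whose remainder lies in the union of a fixed number of
   translates of the set where the coloring is not locally constant.
   The colors are tuples of 3-colorings, one for each [g] in [F].  The latter are
   computed from a window whose length depends on the number of sets in the given
   free cover, but with staggered thresholds, so that a point near a boundary is
   responsible for boundedly many discontinuities whatever that number is.  The
   remainder is thus dominated by a number of copies of the marker set [V] that is
   known before [V] is chosen.

   For comparison, a compactness argument with invariant measures gives a uniform
   gap between the numbers of visits to [A] and to [B] along all sufficiently
   invariant finite sets.  Inside the towers of a castle the visits are then
   matched by a topological version of Hall's theorem, which needs no clopen
   partition of the bases; the remainder goes to a sparse marker set reserved
   in [B]. *)
Require Import Defs.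
From HB Require Import structures.
From mathcomp Require Import all_boot all_order all_algebra finmap.
From mathcomp Require Import all_classical all_reals all_analysis.
From mathcomp Require Import zify lra.

Set Implicit Arguments.
Unset Strict Implicit.
Unset Printing Implicit Defensive.

Import Order.TTheory GRing.Theory Num.Theory.
Import numFieldNormedType.Exports.

Local Open Scope classical_set_scope.

(** * Compact spaces and topological matching *)

Lemma metrizable_hausdorff (R : realType) (X : topologicalType) :
  metrizable R X -> hausdorff_space X.
Proof.
move=> [d [d0 dC dT dN]] p q pq; apply/d0.
have dpp x : d x x = 0%R by exact/d0.
have dge0 : (0 <= d p q)%R by have := dT p q p; rewrite dpp (dC q p); lra.
apply/eqP; case: ltgtP dge0 => // dpos _; exfalso.
have e2 : (0 < d p q / 2)%R by lra.
have [] := pq [set y | (d p y < d p q / 2)%R] [set y | (d q y < d p q / 2)%R].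
- by apply/dN; exists (d p q / 2)%R.
- by apply/dN; exists (d p q / 2)%R.
move=> z [/= pz qz]; have := dT p z q; rewrite (dC z q); lra.
Qed.

Section compact_spaces.
Context (X : topologicalType).

(** Near-covering compactness, applied to the filter of large index sets. The subfamily is given by
    a map from a finite type, so that [I] can be any type. *)
Lemma compact_finite_cover (A : set X) (I : Type) (f : I -> set X) :
  compact A -> (forall i, open (f i)) -> A `<=` \bigcup_i f i ->
  exists (J : finType) (u : J -> I), A `<=` \bigcup_j f (u j).
Proof.
move=> /compact_near_coveringP cA fo Af.
(* the filter of large sets of indices, generated by the finite sets *)
pose F : set_system (set I) := [set P | exists (J : finType) (u : J -> I),
  forall s : set I, range u `<=` s -> P s].
have FF : Filter F.
  split.
  - by exists void, (fun v : void => match v with end).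
  - move=> P Q [J [u uP]] [K [v vQ]].
    exists (J + K)%type, (fun x => match x with inl j => u j | inr k => v k end).
    move=> s us; split; first by apply: uP => _ [j _ <-]; apply: us; exists (inl j).
    by apply: vQ => _ [j _ <-]; apply: us; exists (inr j).
  - by move=> P Q PQ [J [u uP]]; exists J, u => s /uP/PQ.
have [|J [u uA]] := cA _ F (fun s x => exists2 i, s i & f i x) FF.
  move=> x /Af[i _ fix_]; exists (f i, [set s : set I | s i]).
    split; first by apply: open_nbhs_nbhs; split => //; exact: fo.
    by exists unit, (fun=> i) => s si; apply: si; exists tt.
  by case=> y s /= [fiy si]; exists i.
exists J, u => x /(uA _ (@subset_refl _ _))[_ [j _ <-] fx].
by exists j.
Qed.

Lemma closed_bigcup_fin (J : finType) (P : set J) (f : J -> set X) :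
  (forall j, P j -> closed (f j)) -> closed (\bigcup_(j in P) f j).
Proof. by apply: closed_bigcup; exact: finite_finset. Qed.

Hypotheses (X_hausdorff : hausdorff_space X) (X_compact : compact [set: X]).

Lemma closed_compact (A : set X) : closed A -> compact A.
Proof. by move=> cA; exact: subclosed_compact cA X_compact _. Qed.

(** By regularity each point of [A] has an open neighborhood whose closure lies in some [P i].
    Finitely many of these cover [A], and [O i] collects those assigned to [i]. *)
Lemma closed_cover_shrink (A : set X) (I : finType) (P : I -> set X) :
  closed A -> (forall i, open (P i)) -> A `<=` \bigcup_i P i ->
  exists O : I -> set X, [/\ forall i, open (O i),
    forall i, closure (O i) `<=` P i & A `<=` \bigcup_i O i].
Proof.
move=> cA oP AP.
pose K := {Oi : set X * I | open Oi.1 /\ closure Oi.1 `<=` P Oi.2}.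
have [k|x Ax|J [u uA]] :=
    @compact_finite_cover A K (fun k => (sval k).1) (closed_compact cA).
- by have [] := svalP k.
- have [i _ Pix] := AP _ Ax.
  have nP : nbhs x (P i) by apply: open_nbhs_nbhs; split.
  have [B nB cB] : filter_from (nbhs x) closure (P i).
    exact: (compact_regular X_hausdorff X_compact (@filterT _ (nbhs x) _)).
  have Bo : open B° /\ closure (B°) `<=` P i.
    split; first exact: open_interior.
    by apply: subset_trans cB; apply: closureS; exact: interior_subset.
  by exists (exist _ (B°, i) Bo : K).
exists (fun i => \bigcup_(j in [set j | (sval (u j)).2 = i]) (sval (u j)).1).
split=> [i|i|x /uA[j _ uj]].
- by apply: bigcup_open => j _; have [] := svalP (u j).
- have cl : closed
      (\bigcup_(j in [set j | (sval (u j)).2 = i]) closure (sval (u j)).1).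
    by apply: closed_bigcup_fin => j _; exact: closed_closure.
  apply: (@subset_trans _
      (\bigcup_(j in [set j | (sval (u j)).2 = i]) closure (sval (u j)).1)).
    rewrite [X in _ `<=` X](closure_id _).1 //; apply: closureS.
    by apply: subset_bigcup => j _; exact: subset_closure.
  by move=> x [j /= <-]; have [_] := svalP (u j); apply.
- by exists (sval (u j)).2 => //; exists j.
Qed.

(** Normality gives an open [W i] around [Z i] whose closure misses the other [Z j]. Subtracting the
    closures of the other [W j] makes these sets disjoint and keeps all of [Z i]. *)
Lemma closed_disjoint_nbhds (I : finType) (Z : I -> set X) (B : set X) :
  (forall i, closed (Z i)) -> (forall i j x, Z i x -> Z j x -> i = j) ->
  open B -> (forall i, Z i `<=` B) ->
  exists U : I -> set X, [/\ forall i, open (U i), forall i, Z i `<=` U i,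
    forall i, U i `<=` B & forall i j x, U i x -> U j x -> i = j].
Proof.
move=> cZ dZ oB ZB.
have step i : exists O : set X, [/\ open O, Z i `<=` O &
    forall j x, closure O x -> Z j x -> i = j].
  have nX := compact_normal X_hausdorff X_compact.
  have cD : closed (\bigcup_(j in [set j | j != i]) Z j).
    by apply: closed_bigcup_fin.
  have [|V nV cV] := nX (Z i) (cZ i) (~` \bigcup_(j in [set j | j != i]) Z j).
    apply/set_nbhsP; exists (~` \bigcup_(j in [set j | j != i]) Z j); split=> //.
      exact: closed_openC.
    by move=> x Zx [j /= /eqP ji Zj]; apply: ji; exact: dZ Zj Zx.
  move/set_nbhsP : nV => [W [oW ZW WV]].
  exists W; split=> // j x /(closureS WV)/cV nD Zj.
  by apply/eqP; apply: contra_notT nD => ij; exists j => //=; rewrite eq_sym.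
have /choice[W WP] := step.
have oW i : open (W i) by case: (WP i).
exists (fun i => B `&` W i `&` ~` \bigcup_(j in [set j | j != i]) closure (W j)).
split.
- move=> i; apply: openI; first exact: openI.
  apply: closed_openC; apply: closed_bigcup_fin => j _; exact: closed_closure.
- move=> i x Zx; split; first by split; [exact: ZB Zx|have [_ ZW _] := WP i; exact: ZW].
  move=> [j /= /eqP ji cWj]; apply: ji.
  by have [_ _ /(_ _ _ cWj Zx)] := WP j.
- by move=> i x [[]].
- move=> i j x [[_ _] nO] [[_ Wjx] _]; apply/eqP; apply: contra_notT nO => ij.
  by exists j => /=; [rewrite eq_sym|exact: subset_closure].
Qed.

(* On the closed set of points where the two counts agree, the patterns
   [{k | C k y}] and [{j | B j y}] are locally constant, because the first can
   only shrink and the second only grow near a point.  Hence the last open set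
   can be given, near the points where it is indispensable, to a canonically
   chosen [k]; removing it preserves the inequality. *)
Lemma topological_matching (I J : finType) (s : seq J)
    (C : I -> set X) (B : J -> set X) :
  uniq s -> (forall k, closed (C k)) -> (forall j, open (B j)) ->
  (forall y, \sum_k `[< C k y >] <= \sum_(j <- s) `[< B j y >])%N ->
  exists U : I -> J -> set X, [/\ forall k j, open (U k j),
    forall k j, U k j `<=` B j,
    forall k, C k `<=` [set y | exists2 j, j \in s & U k j y] &
    forall j k k' y, U k j y -> U k' j y -> k = k'].
Proof.
elim: s C => [|j0 s IHs] C.
  move=> _ cC oB CB; exists (fun _ _ => set0); split=> [k j|k j y []|k y Cky|//].
    exact: open0.
  have := CB y; rewrite big_nil leqn0 sum_nat_eq0 => /forallP/(_ k)/=.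
  by rewrite (asboolT Cky).
move=> /= /andP[j0s us] cC oB CB.
pose cC_ y : nat := (\sum_k `[< C k y >])%N.
pose cB y : nat := (\sum_(j <- j0 :: s) `[< B j y >])%N.
pose Z k := [set y | [/\ (cB y <= cC_ y)%N, B j0 y &
                         [pick k | `[< C k y >]] = Some k]].
have ZC k : Z k `<=` C k.
  by move=> y [_ _]; case: pickP => // k' /asboolP Ck' [<-].
have cZ k : closed (Z k).
  move=> y cly.
  have nC : \forall z \near y, forall k, C k z -> C k y.
    apply: filter_forall => k'; have [Cy|nCy] := pselect (C k' y).
      by apply: nearW.
    have : nbhs y (~` C k') by apply: open_nbhs_nbhs; split=> //; exact: closed_openC.
    by apply: filterS => z.
  have nB : \forall z \near y, forall j, B j y -> B j z.
    apply: filter_forall => j; have [By|nBy] := pselect (B j y).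
      have : nbhs y (B j) by apply: open_nbhs_nbhs; split.
      by apply: filterS => z.
    by apply: nearW.
  have [z [[Bz j0z pz] [Cz Bz']]] := cly _ (filterI nC nB).
  have leC k' : (`[< C k' z >] <= `[< C k' y >])%N.
    by case: asboolP => // /Cz/asboolT ->.
  have leB j : (`[< B j y >] <= `[< B j z >])%N.
    by case: asboolP => // /Bz'/asboolT ->.
  have lec : (cC_ z <= cC_ y)%N by apply: leq_sum.
  have leb : (cB y <= cB z)%N by apply: leq_sum.
  have leCB : (cC_ y <= cB y)%N by exact: CB.
  (* The chain [cB z <= cC_ z <= cC_ y <= cB y <= cB z] closes up, so the sums agree, and then so do
     their terms. *)
  have eqC k' : `[< C k' y >] = `[< C k' z >].
    have le' : (\sum_(i | i != k') `[< C i z >] <= \sum_(i | i != k') `[< C i y >])%N.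
      by apply: leq_sum.
    have Ey : cC_ y = (`[< C k' y >] + \sum_(i | i != k') `[< C i y >])%N.
      by rewrite /cC_ (bigD1 k').
    have Ez : cC_ z = (`[< C k' z >] + \sum_(i | i != k') `[< C i z >])%N.
      by rewrite /cC_ (bigD1 k').
    move: (leC k') Ey Ez; case: asboolP => _; case: asboolP => _ //= _; lia.
  have eqB : `[< B j0 y >] = `[< B j0 z >].
    have le' : (\sum_(j <- s) `[< B j y >] <= \sum_(j <- s) `[< B j z >])%N.
      by apply: leq_sum.
    have Ey : cB y = (`[< B j0 y >] + \sum_(j <- s) `[< B j y >])%N.
      by rewrite /cB big_cons.
    have Ez : cB z = (`[< B j0 z >] + \sum_(j <- s) `[< B j z >])%N.
      by rewrite /cB big_cons.
    move: (leB j0) Ey Ez; case: asboolP => _; case: asboolP => _ //= _; lia.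
  split; first by lia.
    by apply/asboolP; rewrite eqB; exact/asboolP.
  by rewrite -pz; apply: eq_pick => k'; rewrite eqC.
have dZ k k' y : Z k y -> Z k' y -> k = k'.
  by move=> [_ _ pk] [_ _]; rewrite pk => -[].
have [V [oV ZV VB dV]] := closed_disjoint_nbhds cZ dZ (oB j0)
  (fun k y (Zy : Z k y) => let: And3 _ By _ := Zy in By).
have [||||U [oU UB CU dU]] := IHs (fun k => C k `\` V k) => //.
- by move=> k; apply: closedI => //; exact: open_closedC.
- move=> y; have := CB y; rewrite big_cons.
  have le' : (\sum_k `[< (C k `\` V k) y >] <= \sum_k `[< C k y >])%N.
    apply: leq_sum => k _; case: asboolP => // -[Cy _].
    by rewrite asboolT.
  case: asboolP => [By|_]; last by move/(leq_trans le').
  (* With slack, the loss of [B j0] is affordable. In the tight case the chosen [k] satisfies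
     [Z k y], so that [V k] removes one term from the left side as well. *)
  have [tight|loose] := leqP (cB y) (cC_ y); last first.
    move=> _; move: loose; rewrite /cB big_cons asboolT // => loose.
    by apply: leq_trans le' _; rewrite -ltnS.
  case pk: [pick k | `[< C k y >]] => [k|].
    have Zk : Z k y by split.
    have Vk := ZV _ _ Zk; have Ck := ZC _ _ Zk.
    have EC : (\sum_k `[< C k y >] = 1 + \sum_(i | i != k) `[< C i y >])%N.
      by rewrite (bigD1 k) //= asboolT.
    have ECV : (\sum_k `[< (C k `\` V k) y >] =
                \sum_(i | i != k) `[< (C i `\` V i) y >])%N.
      rewrite (bigD1 k) //= (_ : `[< _ >] = false) //.
      by apply/asboolPn => -[].
    have le2 : (\sum_(i | i != k) `[< (C i `\` V i) y >] <=
                \sum_(i | i != k) `[< C i y >])%N.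
      by apply: leq_sum => i _; case: asboolP => // -[Cy _]; rewrite asboolT.
    by rewrite EC ECV; lia.
  move=> _; move: pk; case: pickP => // nC _; rewrite big1 // => k _.
  by have := nC k; case: asboolP => // nCk _; rewrite asboolF // => -[].
exists (fun k j => if j == j0 then V k else if j \in s then U k j else set0).
split.
- move=> k j; case: ifP => _; first exact: oV.
  by case: ifP => _; [exact: oU|exact: open0].
- move=> k j; case: ifP => [/eqP ->|_]; first exact: VB.
  by case: ifP => _; [exact: UB|exact: sub0set].
- move=> k y Cy; have [Vy|nVy] := pselect (V k y).
    by exists j0; rewrite ?inE eqxx.
  have [|j js Uj] := CU k y; first by [].
  exists j; first by rewrite inE js orbT.
  by rewrite ifN ?js //; apply: contraNneq j0s => <-.
- move=> j k k' y; case: ifP => _; first exact: dV.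
  by case: ifP => // _; exact: dU.
Qed.

End compact_spaces.

(** * Transport and domination along an action *)

Section homeomorphisms.
Context (G : groupType) (X : topologicalType) (act : G -> X -> X).
Hypothesis act_homeo : action_by_homeo act.

Lemma act1 x : act 1%g x = x.
Proof. by case: act_homeo. Qed.

Lemma actM g h x : act (g * h)%g x = act g (act h x).
Proof. by case: act_homeo. Qed.

Lemma actK g : cancel (act g) (act g^-1%g).
Proof. by move=> x; rewrite -actM mulVg act1. Qed.

Lemma actVK g : cancel (act g^-1%g) (act g).
Proof. by move=> x; rewrite -actM mulgV act1. Qed.

Lemma act_inj g : injective (act g).
Proof. exact: can_inj (actK g). Qed.

Lemma open_act_preimage g (U : set X) : open U -> open (act g @^-1` U).
Proof.
by move=> oU; apply: open_comp => // x _; case: act_homeo => _ _; apply.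
Qed.

Lemma closed_act_preimage g (U : set X) : closed U -> closed (act g @^-1` U).
Proof.
by move=> cU; apply: closed_comp => // x _; case: act_homeo => _ _; apply.
Qed.

Lemma image_act g (U : set X) : act g @` U = act g^-1%g @^-1` U.
Proof.
apply/seteqP; split=> [_ [y Uy <-]|x /= Ux]; first by rewrite /= actK.
by exists (act g^-1%g x) => //; rewrite actVK.
Qed.

(** Lets a finite type index the cover in place of numbers; the numbers from [#|K|] on get the empty
    set. *)
Lemma subequivalent_fin (A B : set X) (K : finType) (U : K -> set X)
    (g : K -> G) :
  (forall k, open (U k)) -> A `<=` \bigcup_k U k ->
  (forall k y, U k y -> B (act (g k) y)) ->
  (forall k l y z, U k y -> U l z -> act (g k) y = act (g l) z -> k = l) ->
  subequivalent act (fun _ : unit => A) B.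
Proof.
move=> oU AU UB dU.
pose idx (n : nat) : option K := omap enum_val (insub n : option 'I_#|K|).
have idxP k : idx (enum_rank k) = Some k.
  by rewrite /idx valK /= enum_rankK.
have idx_inj m n k : idx m = Some k -> idx n = Some k -> m = n.
  rewrite /idx; case: insubP => //= i _ <-; case: insubP => //= j _ <- [<-] [].
  by move/enum_val_inj ->.
exists (fun=> #|K|), (fun _ n => oapp U set0 (idx n)),
  (fun _ n => oapp g 1%g (idx n)); split.
- by move=> _ n _; case: (idx n) => //=; exact: open0.
- move=> _ x /AU[k _ Ukx]; exists (enum_rank k); first exact: ltn_ord.
  by rewrite idxP.
- by move=> _ n _ _ [y + <-]; case: (idx n) => //= k; exact: UB.
- move=> [[] m] [[] n] /= _ _ [x [[y + <-] [z]]].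
  case Em: (idx m) => [k|] //= Uky; case En: (idx n) => [l|] //= Ulz Eyz.
  have kl := dU _ _ _ _ Uky Ulz (esym Eyz).
  by congr (_, _); apply: idx_inj Em _; rewrite En kl.
Qed.

Hypotheses (X_hausdorff : hausdorff_space X) (X_compact : compact [set: X]).

(** The pieces of [A] are moved by [a k] to a common place, where topological matching assigns them
    to the targets [Q j]; from there [b j] carries them disjointly into [B]. Shrinking the cover
    first supplies the closed sets to be matched. *)
Lemma transport_subequivalent (A B : set X) (I J : finType)
    (P : I -> set X) (a : I -> G) (Q : J -> set X) (b : J -> G) :
  closed A -> (forall k, open (P k)) -> A `<=` \bigcup_k P k ->
  (forall j, open (Q j)) -> (forall j y, Q j y -> B (act (b j) y)) ->
  (forall j j' y y', Q j y -> Q j' y' -> act (b j) y = act (b j') y' ->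
     j = j') ->
  (forall y, \sum_k `[< (A `&` P k) (act (a k)^-1%g y) >] <=
             \sum_j `[< Q j y >])%N ->
  subequivalent act (fun _ : unit => A) B.
Proof.
move=> cA oP AP oQ QB dQ cnt.
have [V [oV VP AV]] := closed_cover_shrink X_hausdorff X_compact cA oP AP.
have [||//||U [oU UQ CU dU]] := @topological_matching X X_hausdorff X_compact I J
  (index_enum J) (fun k => act (a k)^-1%g @^-1` (A `&` closure (V k))) Q.
- exact: index_enum_uniq.
- move=> k; apply: closed_act_preimage; apply: closedI => //.
  exact: closed_closure.
- move=> y; apply: leq_trans (cnt y); apply: leq_sum => k _.
  case: asboolP => // -[Ay /VP Py].
  by rewrite asboolT.
apply: (@subequivalent_fin _ _ (I * J)%type
    (fun kj => act (a kj.1) @^-1` U kj.1 kj.2) (fun kj => b kj.2 * a kj.1)%g).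
- by move=> kj; exact: open_act_preimage.
- move=> x Ax; have [k _ Vx] := AV _ Ax.
  have [|j _ Uj] := CU k (act (a k) x).
    by rewrite /= actK; split=> //; exact: subset_closure.
  by exists (k, j).
- by move=> [k j] y /= /UQ/QB; rewrite actM.
- move=> [k j] [k' j'] y z /= Uy Uz; rewrite !actM => E.
  have jj := dQ _ _ _ _ (UQ _ _ _ Uy) (UQ _ _ _ Uz) E; subst j'.
  move/act_inj : E Uy => -> Uy.
  by rewrite (dU _ _ _ _ Uy Uz).
Qed.

(** Subequivalence with multiplicity: the translates of the covering sets may overlap, at [z] up to
    [w z] times. *)
Definition dominated (A : set X) (w : X -> nat) : Prop :=
  exists (I : finType) (P : I -> set X) (h : I -> G),
    [/\ forall i, open (P i), A `<=` \bigcup_i P i &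
        forall z, (\sum_i `[< P i (act (h i)^-1%g z) >] <= w z)%N].

Lemma dominated_le (A A' : set X) (w w' : X -> nat) :
  A `<=` A' -> (forall z, w' z <= w z)%N -> dominated A' w' -> dominated A w.
Proof.
move=> AA' ww' [I [P [h [oP A'P Pw]]]]; exists I, P, h; split=> //.
  exact: subset_trans A'P.
by move=> z; exact: leq_trans (Pw z) (ww' z).
Qed.

Lemma dominated_open (U : set X) : open U -> dominated U (fun z => `[< U z >]).
Proof.
move=> oU; exists unit, (fun=> U), (fun=> 1%g); split=> // [x Ux|z].
  by exists tt.
by rewrite (bigD1 tt) //= invg1 act1 big1 ?addn0 // => -[].
Qed.

Lemma dominated_bigcup (J : finType) (A : J -> set X) (w : J -> X -> nat) :
  (forall j, dominated (A j) (w j)) ->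
  dominated (\bigcup_j A j) (fun z => \sum_j w j z)%N.
Proof.
move=> domA.
pose I j := projT1 (cid (domA j)); pose domI j := projT2 (cid (domA j)).
pose P j : I j -> set X := projT1 (cid (domI j)).
pose domP j := projT2 (cid (domI j)).
pose h j : I j -> G := projT1 (cid (domP j)).
have hP j : [/\ forall i, open (P j i), A j `<=` \bigcup_i P j i &
    forall z, (\sum_i `[< P j i (act (h j i)^-1%g z) >] <= w j z)%N].
  exact: (projT2 (cid (domP j))).
exists {j : J & I j}, (fun u => P (tag u) (tagged u)),
  (fun u => h (tag u) (tagged u)); split.
- by move=> [j i] /=; have [] := hP j.
- move=> x [j _ Ajx]; have [_ /(_ _ Ajx)[i _ Pix] _] := hP j.
  by exists (Tagged I i).
- move=> z; rewrite -(sig_big_dep (fun=> true) (fun _ _ => true)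
    (fun j i => `[< P j i (act (h j i)^-1%g z) >] : nat)) /=.
  by apply: leq_sum => j _; have [_ _] := hP j.
Qed.

Lemma dominated_preimage g (A : set X) w :
  dominated A w -> dominated (act g @^-1` A) w.
Proof.
move=> [I [P [h [oP AP Pw]]]].
exists I, (fun i => act g @^-1` P i), (fun i => h i * g)%g; split=> [i|x|z].
- exact: open_act_preimage.
- by move=> /AP[i _ Pi]; exists i.
- apply: leq_trans (Pw z); rewrite leq_eqVlt; apply/orP; left; apply/eqP.
  by apply: eq_bigr => i _; rewrite /= invgM actM actVK.
Qed.

(** The count vanishes outside [U], so [act (h i)] maps [P i] into [U]. Each piece can thus be cut
    along the sets [V k] and moved on by [g k]. *)
Lemma dominated_trans (A : set X) (N : nat) (U : set X) (K : finType)
    (V : K -> set X) (g : K -> G) :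
  dominated A (fun z => N * `[< U z >])%N ->
  (forall k, open (V k)) -> U `<=` \bigcup_k V k ->
  dominated A (fun z => N * \sum_k `[< V k (act (g k)^-1%g z) >])%N.
Proof.
move=> [I [P [h [oP AP Pw]]]] oV UV.
exists (K * I)%type, (fun ki => P ki.2 `&` act (h ki.2) @^-1` V ki.1),
  (fun ki => g ki.1 * h ki.2)%g; split.
- by move=> [k i] /=; apply: openI => //; exact: open_act_preimage.
- move=> x /AP[i _ Pix].
  have [|k _ Vk] := UV (act (h i) x).
    have := Pw (act (h i) x); case: asboolP => // _.
    rewrite muln0 leqn0 sum_nat_eq0 => /forallP/(_ i) /=.
    by rewrite actK asboolT.
  by exists (k, i).
- move=> z; rewrite -(pair_big xpredT xpredT (fun k i =>
    `[< (P i `&` act (h i) @^-1` V k) (act (g k * h i)^-1%g z) >] : nat)) /=.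
  rewrite big_distrr; apply: leq_sum => k _ /=.
  case: asboolP => [Vk|nVk]; last first.
    rewrite muln0 big1 // => i _; rewrite asboolF // => -[_] /=.
    by rewrite invgM actM actVK.
  apply: (@leq_trans (N * `[< U (act (g k)^-1%g z) >])); last first.
    by rewrite leq_mul2l leq_b1 orbT.
  apply: leq_trans (Pw _); apply: leq_sum => i _.
  case: asboolP => //= -[+ _]; rewrite invgM actM => Pi.
  by rewrite asboolT.
Qed.

End homeomorphisms.

(** * Colorings with few discontinuities *)

Section greedy_colorings.

Definition avoid (T : finType) (x0 : T) (s : seq T) : T :=
  odflt x0 [pick x | x \notin s].

Lemma avoidP (T : finType) (x0 : T) (s : seq T) :
  (size s < #|T|)%N -> avoid x0 s \notin s.
Proof.
rewrite /avoid => ltsT; case: pickP => // sT; exfalso.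
have : (#|T| <= size s)%N.
  rewrite (leq_trans _ (card_size s)) //; apply: subset_leq_card.
  by apply/fintype.subsetP => x _; have /negbFE := sT x.
by rewrite leqNgt ltsT.
Qed.

(* The greedy 3-coloring of the positions of a word of codes, in increasing
   order of the codes; [n] is fuel, sufficient as soon as it exceeds the code. *)
Fixpoint greedy3 (n : nat) (w : nat -> nat) (k : nat) : 'I_3 :=
  if n is n'.+1 then
    avoid ord0 ((if w k.+1 < w k then [:: greedy3 n' w k.+1] else [::]) ++
                (if w k.-1 < w k then [:: greedy3 n' w k.-1] else [::]))%N
  else ord0.

Lemma greedy3_stable n w k : (w k < n)%N -> greedy3 n.+1 w k = greedy3 n w k.
Proof.
elim: n k => // n IHn k wk /=; congr (avoid _ (_ ++ _)).
- case: ifP => // lt1; congr [:: _]; apply: IHn.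
  exact: leq_trans lt1 _.
- case: ifP => // lt1; congr [:: _]; apply: IHn.
  exact: leq_trans lt1 _.
Qed.

Lemma greedy3_succ n w k : (w k.+1 < w k)%N ->
  greedy3 n.+1 w k != greedy3 n w k.+1.
Proof.
move=> lt /=; rewrite lt /= eq_sym.
set l := _ :: _; have : avoid ord0 l \notin l.
  by apply: avoidP; rewrite card_ord /l; case: ifP.
by apply: contraNneq => <-; rewrite inE eqxx.
Qed.

Lemma greedy3_pred n w k : (w k.-1 < w k)%N ->
  greedy3 n.+1 w k != greedy3 n w k.-1.
Proof.
move=> lt /=; rewrite lt /= eq_sym.
set l := _ ++ _; have : avoid ord0 l \notin l.
  by apply: avoidP; rewrite card_ord /l; case: ifP.
by apply: contraNneq => <-; rewrite /l mem_cat inE eqxx orbT.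
Qed.

Lemma greedy3_adjacent n w k : (w k <= n)%N -> (w k.+1 <= n)%N ->
  w k <> w k.+1 -> greedy3 n.+1 w k != greedy3 n.+1 w k.+1.
Proof.
move=> wk wk1 /eqP; rewrite neq_ltn => /orP[lt|lt].
- rewrite (greedy3_stable (leq_trans lt wk1)) eq_sym.
  exact: (@greedy3_pred n w k.+1).
- rewrite (greedy3_stable (leq_trans lt wk)).
  exact: greedy3_succ.
Qed.

(** The recursion reaches at most [n] positions away from [k]. The bound [n <= k] keeps it clear of
    position 0, where the truncated predecessor does not commute with the shift. *)
Lemma greedy3_shift n w w' k : (n <= k)%N ->
  (forall j, (j <= k + n)%N -> w' j = w j.+1) ->
  greedy3 n w' k = greedy3 n w k.+1.
Proof.
elim: n k => // n IHn [//|k] nk ww' /=.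
rewrite !ww' ?leq_addr //; try lia.
rewrite IHn; [|lia|by move=> j jk; apply: ww'; lia].
rewrite IHn; [by []|lia|by move=> j jk; apply: ww'; lia].
Qed.

Lemma greedy3_local n w w' k : (forall j, (j <= k + n)%N -> w j = w' j) ->
  greedy3 n w k = greedy3 n w' k.
Proof.
elim: n k => // n IHn k ww' /=.
rewrite !ww'; try lia.
rewrite IHn; [|by move=> j jk; apply: ww'; lia].
rewrite IHn; [by []|by move=> j jk; apply: ww'; lia].
Qed.

End greedy_colorings.

(** A Urysohn function for the complement of [U] and the part of [closure U] outside [V], which are
    disjoint because a common point would lie in the boundary of [U]. Intermediate values occur only
    in [U] and [V] together. *)
Lemma shell_function (R : realType) (X : topologicalType) (U V : set X) :
  normal_space X -> open U -> open V -> boundary U `<=` V ->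
  exists f : X -> R, [/\ continuous f, forall x, (0 <= f x <= 1)%R,
    forall x, ~ U x -> f x = 0%R & forall x, U x -> ~ V x -> f x = 1%R].
Proof.
move=> nX oU oV UV.
have sep : uniform_separator (~` U) (closure U `&` ~` V).
  have [nsep _] := @normal_separatorP R X; apply: nsep => //.
  - exact: open_closedC.
  - by apply: closedI; [exact: closed_closure|exact: open_closedC].
  - rewrite -subset0 => x [nUx [cUx nVx]]; apply: nVx; apply: UV; split=> //.
    by move/interior_subset.
exists (Urysohn (~` U) (closure U `&` ~` V)); split.
- exact: Urysohn_continuous.
- move=> x; have /= := @Urysohn_range _ R (~` U) (closure U `&` ~` V).
  by move/(_ _ (ex_intro2 _ _ x I erefl)); rewrite /= in_itv.
- by move=> x nUx; apply: (Urysohn_sub0 sep); exists x.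
- move=> x Ux nVx; apply: (Urysohn_sub1 sep); exists x => //.
  by split=> //; exact: subset_closure.
Qed.

(** With [n] the integer part of [t], only [p = n], [n - 1], [n - 2] can contribute. *)
Lemma count_unit_window (R : realType) (N : nat) (t : R) :
  (\sum_(p < N) (p%:R < t < p%:R + 3)%R <= 3)%N.
Proof.
have [t0|t0] := ltP t 0%R.
  rewrite big1 // => p _; apply/eqP; rewrite eqb0 negb_and -leNgt.
  by rewrite (le_trans (ltW t0)) ?ler0n.
have /andP[nt tn] := truncn_itv t0; set n := Num.Def.trunc t in nt tn.
have one (q : nat) : (\sum_(p < N) (p + q == n :> nat) <= 1)%N.
  case: (pickP (fun p : 'I_N => p + q == n)%N) => [p /eqP pq|none].
    rewrite (bigD1 p) //= pq eqxx big1 // => p' pp'.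
    by rewrite -pq eqn_add2r val_eqE (negbTE pp').
  by rewrite big1 // => p _; rewrite none.
apply: (@leq_trans (\sum_(p < N) ((p + 0 == n) + (p + 1 == n) + (p + 2 == n)))).
  apply: leq_sum => p _; case: andP => // -[pt tp].
  have : (p < n.+1)%N by rewrite -(ltr_nat R); exact: lt_trans pt tn.
  have : (n < p + 3)%N by rewrite -(ltr_nat R) natrD; exact: le_lt_trans nt tp.
  lia.
by rewrite !big_split /=; exact: leq_add (leq_add (one 0%N) (one 1%N)) (one 2%N).
Qed.

(** * 3-colorings separating a point from its image under one group element *)

Section three_colorings.
Context (R : realType) (G : groupType) (X : topologicalType).
Context (act : G -> X -> X).
Hypotheses (act_homeo : action_by_homeo act) (X_normal : normal_space X).

Lemma dominatedU (A A' : set X) w w' :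
  dominated act A w -> dominated act A' w' ->
  dominated act (A `|` A') (fun z => w z + w' z)%N.
Proof.
move=> dA dA'.
have := @dominated_bigcup G X act bool (fun b => if b then A else A')
  (fun b => if b then w else w').
move=> /(_ _)[]; first by case.
move=> I [P [h [oP AP Pw]]]; exists I, P, h; split=> //.
- by move=> x Ax; apply: AP; case: Ax => ?; [exists true|exists false].
- by move=> z; rewrite (leq_trans (Pw z)) // big_bool.
Qed.

(* The code of the [k]-th point of an orbit of [g] is read off the level sets
   [f i > k + 2], whose threshold depends on [k].  A given point then lies on a
   level in use for boundedly many positions only, so that the number of
   discontinuities it causes does not depend on the length of the window. *)
Lemma three_coloring (g : G) (m : nat) (U : 'I_m -> set X)
    (V : option 'I_m -> set X) :
  (forall i, open (U i)) -> (forall j, open (V j)) ->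
  (forall i x, U i x -> ~ U i (act g x)) ->
  (forall i, boundary (U i) `<=` V (Some i)) -> (~` \bigcup_i U i) `<=` V None ->
  exists (c : X -> 'I_3) (Bad : option 'I_m -> set X),
    (forall j, dominated act (Bad j) (fun z => 4 * `[< V j z >])%N) /\
    forall x, (forall j, ~ Bad j x) ->
      (\forall y \near x, c y = c x) /\ c x <> c (act g x).
Proof.
move=> oU oV freeU UV V0.
(* Codes are at most [m], so fuel [M] suffices, and position [M] is far enough from 0 for the shift.
   The words of [x] and [act g x] together consult positions up to [M + M + 1]. As [p + 3 <= D] for
   all these positions, the value [D] lies above every interval in use. *)
pose M := m.+1; pose N := (M + M).+2; pose D : R := N.+2%:R%R.
have /choice[f fP] : forall i, exists f : X -> R, [/\ continuous f,
    forall x, (0 <= f x <= D)%R, forall x, ~ U i x -> f x = 0%R &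
    forall x, U i x -> ~ V (Some i) x -> f x = D].
  move=> i.
  have [f [cf f01 f0 f1]] := @shell_function R X _ _ X_normal (oU i) (oV (Some i)) (UV i).
  exists (fun x => D * f x)%R; split.
  - by move=> x; apply: cvgM; [exact: cvg_cst|exact: cf].
  - move=> x; have /andP[f0x f1x] := f01 x.
    by rewrite mulr_ge0 ?ler0n //= ler_piMr ?ler0n.
  - by move=> x /f0 ->; rewrite mulr0.
  - by move=> x Ux /(f1 _ Ux) ->; rewrite mulr1.
pose code t z : nat := find (fun i => (t%:R < f i z)%R) (enum 'I_m).
pose w x k := code k.+2 (act (g ^+ k)%g x).
pose c x := greedy3 M (w x) M.
(* At the point [act (g ^+ p) x] the word of [x] uses the threshold [p + 2] and the word of
   [act g x] uses [p + 1]. Off the open interval from [p] to [p + 3] both comparisons agree and are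
   locally constant. *)
pose P i (p : 'I_N) : set X :=
  [set x | (p%:R < f i (act (g ^+ p)%g x) < p%:R + 3)%R].
pose Bad j : set X := (act (g ^+ M)%g @^-1` V j) `|`
  if j is Some i then \bigcup_p P i p else set0.
have codem t z : (code t z <= m)%N.
  by rewrite /code (leq_trans (find_size _ _)) // size_enum_ord.
have cfg i k x : f i (act (g ^+ k)%g y) @[y --> x] --> f i (act (g ^+ k)%g x).
  have [cf _ _ _] := fP i; apply: (@cvg_comp _ _ _ (act (g ^+ k)%g) (f i)).
    by case: act_homeo => _ _; apply.
  exact: cf.
exists c, Bad; split=> [j|x nBad].
- apply: (@dominated_le _ _ _ _ _ _ (fun z => `[< V j z >] + 3 * `[< V j z >])%N
    (@subset_refl _ _)); first by move=> z; lia.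
  apply: dominatedU.
    by apply: dominated_preimage => //; exact: dominated_open.
  case: j => [i|]; last first.
    exists void, (fun=> set0), (fun=> 1%g); split=> // z.
    by rewrite big1 // => -[].
  exists 'I_N, (P i), (fun p : 'I_N => (g ^+ p)%g); split=> // [p|z].
    rewrite openE => x /= /andP[px xp]; rewrite /interior.
    apply: filterS (filterI (cvgr_gt _ (cfg i p x) _ px)
                            (cvgr_lt _ (cfg i p x) _ xp)).
    by move=> y [py yp]; apply/andP; split.
  have [Vz|nVz] := pselect (V (Some i) z).
    rewrite asboolT // muln1; apply: leq_trans (count_unit_window N (f i z)).
    apply: leq_sum => p _; rewrite /P /= actVK //.
    by case: asboolP => // ->.
  rewrite asboolF // muln0 big1 // => p _; rewrite asboolF // /P /= actVK //.
  have [Uz|nUz] := pselect (U i z); have [_ _ f0 fD] := fP i.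
    rewrite fD // => /andP[_]; rewrite -natrD ltr_nat.
    by have := ltn_ord p; rewrite -/N; lia.
  by rewrite f0 //; rewrite ltrn0.
- have nP i (p : nat) : (p < N)%N -> let t := f i (act (g ^+ p)%g x) in
      (t <= p%:R \/ p%:R + 3 <= t)%R.
    move=> pN t; have nb : ~ P i (Ordinal pN) x.
      by move=> Px; apply: (nBad (Some i)); right; exists (Ordinal pN).
    have [|lt] := leP t p%:R%R; first by left.
    by right; rewrite leNgt; apply/negP => lt'; apply: nb; rewrite /P /= lt.
  have nV j : ~ V j (act (g ^+ M)%g x) by move=> Vj; apply: (nBad j); left.
  have w1 (k : nat) : (k <= M + M)%N -> w (act g x) k = w x k.+1.
    move=> kM; rewrite /w -actM // -expgSr; apply: eq_find => i /=.
    have [le1|le2] := nP i k.+1 kM; apply/idP/idP; rewrite -!natr1; lra.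
  have cM : c (act g x) = greedy3 M (w x) M.+1.
    by rewrite /c; apply: greedy3_shift.
  split.
  - have nw : \forall y \near x, forall (i : 'I_m) (p : 'I_N),
        (p.+2%:R < f i (act (g ^+ p)%g y))%R = (p.+2%:R < f i (act (g ^+ p)%g x))%R.
      apply: filter_forall => i; apply: filter_forall => p.
      have [le1|le2] := nP i p (ltn_ord p).
      - have lt1 : (f i (act (g ^+ p)%g x) < p.+2%:R)%R.
          by rewrite (le_lt_trans le1) // ltr_nat.
        apply: filterS (cvgr_lt _ (cfg i p x) _ lt1) => y /= lty.
        by rewrite !ltNge !ltW.
      - have lt1 : (p.+2%:R < f i (act (g ^+ p)%g x))%R.
          by rewrite (lt_le_trans _ le2) // -natrD ltr_nat; lia.
        apply: filterS (cvgr_gt _ (cfg i p x) _ lt1) => y /= lty.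
        by rewrite lty lt1.
    apply: filterS nw => y wyx; apply: greedy3_local => k kM.
    apply: eq_find => i /=.
    have kN : (k < N)%N by rewrite /N; lia.
    exact: (wyx i (Ordinal kN)).
  - rewrite cM; apply/eqP; apply: greedy3_adjacent; [exact: codem|exact: codem|].
    move=> ww.
    (* If the common code is an index [i], then [U i] contains both [act (g ^+ M) x] and its image
       under [g], against freeness. Otherwise no [U i] contains the point at position [M], which
       then lies in [V None]. *)
    have [has1|nhas] := boolP (has (fun i => (M.+2%:R < f i (act (g ^+ M)%g x))%R)
                             (enum 'I_m)).
    + have [i0 _ _] := hasP has1.
      have := has1; rewrite has_find => ltw.
      have has2 : has (fun i => (M.+3%:R < f i (act (g ^+ M.+1)%g x))%R) (enum 'I_m).
        by rewrite has_find; move: ltw ww; rewrite /w /code => + <-.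
      have := nth_find i0 has1; have := nth_find i0 has2.
      move: ww; rewrite /w /code => -> /=.
      set i := nth _ _ _ => lt2 lt1; have [_ _ f0 _] := fP i.
      have Uf y (t : nat) : (t%:R < f i y)%R -> U i y.
        move=> lt; apply: contrapT => /f0 fy; move: lt; rewrite fy.
        by rewrite ltrn0.
      apply: freeU (Uf _ _ lt1) _.
      by rewrite -actM // -expgS; exact: Uf lt2.
    + have /hasPn nf := nhas.
      have nU i : ~ U i (act (g ^+ M)%g x).
        move=> Ui; have [_ _ _ fD] := fP i.
        have := nf i (mem_enum _ i); rewrite fD // ltr_nat /N.
        by rewrite -leqNgt; lia.
      by apply: (nV None); apply: V0 => -[i _ /nU].
Qed.
End three_colorings.

Lemma sum_asbool_le1 (I : finType) (P : I -> Prop) :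
  (forall i j, P i -> P j -> i = j) -> (\sum_i `[< P i >] <= 1)%N.
Proof.
move=> P1; case: (pickP (fun i => `[< P i >])) => [i /asboolP Pi|none].
  rewrite (bigD1 i) //= asboolT // big1 // => j ji.
  by rewrite asboolF // => /(P1 _ _ Pi) ij; rewrite ij eqxx in ji.
by rewrite big1 // => i _; rewrite none.
Qed.

(** * From 3-colorings to colorings proper for a finite set *)

Section proper_colorings.
Context (R : realType) (G : groupType) (X : topologicalType).
Context (act : G -> X -> X).
Hypotheses (act_homeo : action_by_homeo act) (act_free : free_action act).

(** Freeness identifies each orbit with [G] through a chosen base point. The key only has to order
    the points of an orbit; continuity is not asked of it. *)
Lemma orbit_key : countable [set: G] ->
  exists key : X -> nat, forall g x, key x = key (act g x) -> g = 1%g.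
Proof.
move=> /countable_injP[f f_inj].
have [[x0 _]|X0] := pselect (exists x0 : X, True); last first.
  by exists (fun=> 0%N) => g x; exfalso; apply: X0; exists x.
pose orb x : set X := [set act g x | g in [set: G]].
have orbE g x : orb (act g x) = orb x.
  apply/seteqP; split=> _ [h _ <-].
    by exists (h * g)%g => //; rewrite (actM act_homeo).
  by exists (h * g^-1)%g => //; rewrite -(actM act_homeo) mulgVK.
have /choice[u uP] : forall x, exists g, x = act g (xget x0 (orb x)).
  move=> x; have [h _ <-] : orb x (xget x0 (orb x)).
    by apply: xgetPex; exists x, 1%g => //; rewrite (act1 act_homeo).
  by exists h^-1%g; rewrite (actK act_homeo).
exists (fun x => f (u x)) => g x.
move=> /f_inj; rewrite !in_setE => /(_ I I) ux; apply: (@act_free _ x).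
by rewrite [LHS]uP [RHS]uP orbE ux.
Qed.

Section extension.
Context (F : {fset G}) (T : finType) (t0 : T) (Y : set X) (c1 : X -> T).
Context (key : X -> nat).
Hypotheses (F_sym : symmetric_fset F) (F_card : (#|` F| < #|T|)%N).
Hypothesis key_inj : forall g x, key x = key (act g x) -> g = 1%g.
Hypothesis c1_proper : forall x g, Y x -> Y (act g x) -> g \in F ->
  g != 1%g -> c1 x != c1 (act g x).

Let rank x : nat := if `[< Y x >] then 0%N else (key x).+1.

(** Greedy coloring outside [Y] in the order of [rank], with the points of [Y] first. The fuel [n]
    suffices as soon as it is at least the rank. *)
Fixpoint extension_rec (n : nat) (x : X) : T :=
  if `[< Y x >] then c1 x else
  if n is n'.+1 then
    avoid t0 [seq extension_rec n' (act g x) | g <- F & rank (act g x) < rank x]%N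
  else t0.

Definition extension x := extension_rec (rank x) x.

Lemma extension_recE n x : (rank x <= n)%N -> extension_rec n x = extension x.
Proof.
suff stable m y : (rank y <= m)%N -> extension_rec m.+1 y = extension_rec m y.
  move=> rx; rewrite -(subnK rx) /extension.
  elim: (n - rank x)%N => // k IHk; rewrite addSn stable ?IHk //.
  exact: leq_addl.
elim: m y => [|m IHm] y; rewrite /rank /=.
  by case: ifP.
case: ifP => // nY ry; congr (avoid _ _); apply/eq_in_map => g.
rewrite mem_filter => /andP[rlt _]; apply: IHm.
by rewrite -ltnS (leq_trans rlt) // /rank nY.
Qed.

Lemma extension_on x : Y x -> extension x = c1 x.
Proof. by move=> Yx; rewrite /extension; case: (rank x) => [|n] /=; rewrite asboolT. Qed.

Lemma extension_avoid g x : g \in F -> (rank (act g x) < rank x)%N ->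
  extension x != extension (act g x).
Proof.
move=> gF rlt; rewrite -(extension_recE (n := (rank x).-1) (x := act g x)); last first.
  by rewrite -ltnS (leq_trans rlt) // leqSpred.
move: (rlt); rewrite /extension {2 3}/rank; case: ifP => // nY _ /=; rewrite nY.
set l := map _ _; apply/eqP => E.
have : avoid t0 l \notin l.
  apply: avoidP; rewrite size_map size_filter (leq_ltn_trans _ F_card) //.
  exact: count_size.
rewrite E => /negP; case; apply/mapP; exists g => //.
  by rewrite mem_filter rlt.
by rewrite /rank nY.
Qed.

(** Of two neighbors of different rank the later one avoids the color of the earlier one, by
    symmetry of [F]. Equal ranks mean that both points lie in [Y], or else that their keys agree,
    which is excluded. *)
Lemma extension_proper x g : g \in F -> g != 1%g ->
  extension x != extension (act g x).
Proof.
move=> gF g1; have [lt|gt|eq] := ltngtP (rank (act g x)) (rank x).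
- exact: extension_avoid.
- rewrite eq_sym -[in X in _ != X](actK act_homeo g x).
  by apply: extension_avoid; [exact: F_sym|rewrite (actK act_homeo)].
- move: eq; rewrite /rank; case: asboolP => [Yg|nYg]; case: asboolP => // Yx.
    by move=> _; rewrite !extension_on //; exact: c1_proper.
  by move=> [/esym/key_inj g1E]; rewrite g1E eqxx in g1.
Qed.

End extension.

Hypotheses (X_hausdorff : hausdorff_space X) (X_compact : compact [set: X]).

Lemma subequivalent_dominated (I : finType) (A : I -> set X) (V : set X) :
  subequivalent act A V ->
  exists (K : I -> finType) (W : forall i, K i -> set X) (g : forall i, K i -> G),
    [/\ forall i k, open (W i k), forall i, A i `<=` \bigcup_k W i k &
        forall z, (\sum_i \sum_k `[< W i k (act (g i k)^-1%g z) >] <=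
                   `[< V z >])%N].
Proof.
move=> [m [W [g [oW AW WV dW]]]].
exists (fun i => 'I_(m i)), (fun i (k : 'I_(m i)) => W i k),
  (fun i (k : 'I_(m i)) => g i k).
split=> [i k|i x /AW[k /= km Wk]|z]; first exact: oW.
  by exists (Ordinal km).
have inW i (k : 'I_(m i)) : W i k (act (g i k)^-1%g z) -> (act (g i k) @` W i k) z.
  by move=> Wk; rewrite (image_act act_homeo).
rewrite (sig_big_dep (fun=> true) (fun _ _ => true)
    (fun i (k : 'I_(m i)) => `[< W i k (act (g i k)^-1%g z) >] : nat)) /=.
have [Vz|nVz] := pselect (V z); last first.
  rewrite big1 // => -[i k] _ /=; rewrite asboolF // => /inW zW.
  by apply: nVz; apply: WV zW.
rewrite (asboolT Vz); apply: (@sum_asbool_le1 _ (fun u : {i : I & 'I_(m i)} =>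
  W (tag u) (tagged u) (act (g (tag u) (tagged u))^-1%g z))).
move=> [i k] [j l] /= /inW Wik /inW Wjl.
have [ij kl] : (i, nat_of_ord k) = (j, nat_of_ord l).
  by apply: dW; rewrite /= ?ltn_ord //; exists z.
by subst j; congr existT; exact: val_inj.
Qed.

(** The open sets of the subequivalence are the neighborhoods used by the 3-coloring. Four copies of
    each are needed, and since all of them fit disjointly into [V], four copies of [V] suffice
    altogether. *)
Lemma FCSB_three_coloring (F : {fset G}) (V : set X) :
  FCSB act -> marker_set act V -> 1%g \in F ->
  forall g, g \in F -> g != 1%g ->
  exists (c : X -> 'I_3) (Bad : set X),
    dominated act Bad (fun z => 4 * `[< V z >])%N /\
    forall x, ~ Bad x -> (\forall y \near x, c y = c x) /\ c x <> c (act g x).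
Proof.
move=> [_ fcsb] /fcsb-/(_ F)[n [U [UF]]].
move=> /subequivalent_dominated[K [W [h [oW AW Wh]]]] F1 g gF /eqP g1.
have [|j|i x Ux Ugx|i||c [Bad [domBad cBad]]] :=
    @three_coloring R G X act act_homeo (compact_normal X_hausdorff X_compact)
      g n U (fun j => \bigcup_k W j k).
- by move=> i; have [] := UF i.
- by apply: bigcup_open => k _; exact: oW.
- have [_ tU] := UF i; apply: g1; apply: (tU g 1%g) => //.
  exists (act g x); split; first by exists x.
  by exists (act g x) => //; rewrite (act1 act_homeo).
- exact: (AW (Some i)).
- exact: (AW None).
exists c, (\bigcup_j Bad j); split; last first.
  by move=> x nBad; apply: cBad => j Bj; apply: nBad; exists j.
apply: dominated_le (@subset_refl _ _) _ (dominated_bigcup (fun j =>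
    dominated_trans act_homeo (h j) (domBad j) (oW j) (@subset_refl _ _))).
by move=> z /=; rewrite -big_distrr /= leq_mul2l Wh.
Qed.

(** The product of the 3-colorings is proper outside [B], and the greedy extension repairs it
    elsewhere. The order of quantifiers matters: [N] depends on [F] only, with one factor [#|F|] for
    the 3-colorings and one for the translates of [B]. *)
Lemma FCSB_proper_coloring (F : {fset G}) :
  countable [set: G] -> FCSB act -> symmetric_fset F -> 1%g \in F ->
  exists N : nat, forall V : set X, marker_set act V ->
  exists c : X -> 'I_(3 ^ #|` F|),
    (forall x g, g \in F -> g != 1%g -> c x != c (act g x)) /\
    dominated act [set x | ~ \forall y \near x, c y = c x]
      (fun z => N * `[< V z >])%N.
Proof.
move=> cG fcsb F_sym F1; exists (#|` F| * (#|` F| * 4))%N => V mV.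
have /choice[c3 /choice[Bad c3P]] : forall g : F, exists (c : X -> 'I_3) (Bad : set X),
    dominated act Bad (fun z => 4 * `[< V z >])%N /\
    forall x, ~ Bad x -> (\forall y \near x, c y = c x) /\
      (val g != 1%g -> c x <> c (act (val g) x)).
  move=> g; have [->|g1] := eqVneq (val g) 1%g.
    exists (fun=> ord0), set0; split; last by move=> x _; split=> //; exact: nearW.
    exists void, (fun=> set0), (fun=> 1%g); split=> // z.
    by rewrite big1 // => -[].
  have [c [B [dB cB]]] := FCSB_three_coloring fcsb mV F1 (valP g) g1.
  by exists c, B; split=> // x /cB[].
have cardT : #|{ffun F -> 'I_3}| = (3 ^ #|` F|)%N.
  by rewrite card_ffun card_ord cardfE.
pose c1 x : 'I_(3 ^ #|` F|) := cast_ord cardT (enum_rank [ffun g : F => c3 g x]).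
have c1_inj x y : c1 x = c1 y -> forall g : F, c3 g x = c3 g y.
  move=> /cast_ord_inj/enum_rank_inj/ffunP E g.
  by have := E g; rewrite !ffunE.
have c1_eq x y : (forall g : F, c3 g x = c3 g y) -> c1 x = c1 y.
  by move=> E; congr (cast_ord _ (enum_rank _)); apply/ffunP => g; rewrite !ffunE.
pose B := \bigcup_(g : F) Bad g.
have nB x : ~ B x -> (\forall y \near x, c1 y = c1 x) /\
    forall g, g \in F -> g != 1%g -> c1 x != c1 (act g x).
  move=> nBx; have nBad g : ~ Bad g x by move=> Bg; apply: nBx; exists g.
  split.
    have : \forall y \near x, forall g : F, c3 g y = c3 g x.
      by apply: filter_forall => g; have [_ /(_ x (nBad g))[]] := c3P g.
    by apply: filterS => y; exact: c1_eq.
  move=> g gF g1; apply/eqP => /c1_inj/(_ [` gF]%fset).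
  by have [_ /(_ x (nBad _))[_ /(_ g1)]] := c3P [` gF]%fset.
pose Y : set X := [set x | forall g, g \in F -> g != 1%g -> c1 x != c1 (act g x)].
have [key key_inj] := orbit_key cG.
have F_card : (#|` F| < #|'I_(3 ^ #|` F|)|)%N by rewrite card_ord ltn_expl.
have pos : (0 < 3 ^ #|` F|)%N by rewrite expn_gt0.
pose c := extension F (Ordinal pos) Y c1 key.
exists c; split.
  by move=> x g gF g1; apply: extension_proper => // y h Yy _; exact: Yy.
apply: (@dominated_le _ _ _ _ (\bigcup_(g : F) act (val g) @^-1` B) _
    (fun z => \sum_(g : F) \sum_(g' : F) 4 * `[< V z >])%N); last first.
- apply: dominated_bigcup => g; apply: dominated_preimage => //.
  by apply: dominated_bigcup => g'; have [] := c3P g'.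
- by move=> z; rewrite !sum_nat_const cardfE -!mulnA.
move=> x /= nc; apply: contrapT => nBg; apply: nc.
(* Near a point none of whose translates by [F] lies in [B], all comparisons defining [Y] are
   stable; so the nearby points lie in [Y], where the extension is still [c1]. *)
have nBgx g : g \in F -> ~ B (act g x).
  by move=> gF Bg; apply: nBg; exists [` gF]%fset.
have [c1x Yx] := nB x (fun Bx => nBgx 1%g F1 ltac:(by rewrite (act1 act_homeo))).
have c1gx : \forall y \near x, forall g : F, c1 (act (val g) y) = c1 (act (val g) x).
  apply: filter_forall => g; have [near_g _] := nB _ (nBgx _ (valP g)).
  by have [_ _ cont] := act_homeo; exact: (cont (val g) x _ near_g).
apply: filterS2 c1x c1gx => y Ey Egy.
have Yy : Y y.
  move=> g gF g1; rewrite Ey (Egy [` gF]%fset); exact: Yx.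
by rewrite /c !extension_on.
Qed.

End proper_colorings.

(** * Castles *)

Section castles.
Context (R : realType) (G : groupType) (X : topologicalType).
Context (act : G -> X -> X).
Hypotheses (act_homeo : action_by_homeo act) (act_free : free_action act).
Hypotheses (X_hausdorff : hausdorff_space X) (X_compact : compact [set: X]).

Lemma near_locally_constant (T : Type) (c : X -> T) x :
  (\forall y \near x, c y = c x) ->
  \forall y \near x, c y = c x /\ \forall z \near y, c z = c y.
Proof.
move=> cx; have := nbhs_interior cx; apply: filterS => y iy.
have Ey := nbhs_singleton iy; split=> //.
by apply: filterS iy => z /= ->.
Qed.

Lemma FCSB_castle (K : {fset G}) (eps : R) :
  countable [set: G] -> has_local_tiling_algorithm R G -> FCSB act ->
  (0 < eps)%R ->
  exists N : nat, forall V : set X, marker_set act V ->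
  exists (I : finType) (S : I -> {fset G}) (B : I -> set X),
    [/\ forall i, open (B i), forall i, invariant_fset K eps (S i),
        forall i j s t x y, s \in S i -> t \in S j -> B i x -> B j y ->
          act s x = act t y -> i = j /\ s = t &
        dominated act (~` \bigcup_i tower act (S i) (B i))
          (fun z => N * `[< V z >])%N].
Proof.
move=> cG tiling fcsb eps0.
have [F [D [F_sym D_sym F1 [S [W [phi Sphi]] Stile]]]] := tiling K eps eps0.
have [N NV] := FCSB_proper_coloring R act_homeo act_free X_hausdorff X_compact
  cG fcsb F_sym F1.
exists (#|` D| * (#|` W| * N))%N => V /NV[c [c_proper domc]].
pose z x : G -> 'I_(3 ^ #|` F|) := fun h => c (act h x).
have zF x : colorings F (z x).
  move=> g h gF g1; rewrite /z (actM act_homeo).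
  exact: c_proper.
(* Equivariance: moving the point amounts to moving the place of evaluation, so the value at 1 alone
   can define the bases. *)
have Sz x h : S (z (act h x)) 1%g = S (z x) h.
  rewrite (Sphi (z x) h (zF x)) (Sphi (z (act h x)) 1%g (zF _)).
  by congr phi; apply/funext => w; rewrite /z mulg1 (actM act_homeo).
pose cst x := \forall y \near x, c y = c x.
pose I := {A : fpowerset D | `[< invariant_fset K eps (val A) >]}.
pose B (A : I) : set X :=
  [set x | S (z x) 1%g = Some (val A) /\ forall w : W, cst (act (val w) x)].
exists I, (fun A => val (val A)), B; split.
- move=> A; rewrite openE => x [SA cx]; rewrite /interior.
  have : \forall y \near x, forall w : W,
      c (act (val w) y) = c (act (val w) x) /\ cst (act (val w) y).
    apply: filter_forall => w.
    have [_ _ cont] := act_homeo.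
    exact: (cont (val w) x _ (near_locally_constant (cx w))).
  apply: filterS => y cy; split; last by move=> w; have [] := cy w.
  rewrite -SA (Sphi _ _ (zF x)) (Sphi _ _ (zF y)); congr phi.
  by apply/funext => w; rewrite /z mulg1; have [] := cy w.
- by move=> A; exact/asboolP/(valP A).
(* A common point of two levels makes the tiles of [z x] centered at 1 and at [t^-1 * s] share the
   element [s], so these centers coincide. *)
- move=> A A' s t x y sA tA [SA _] [SA' _] E.
  have Ey : y = act (t^-1 * s)%g x by rewrite (actM act_homeo) E (actK act_homeo).
  have [[dis _] _] := Stile _ (zF x).
  have SA1 : S (z x) (t^-1 * s)%g = Some (val A') by rewrite -Sz -Ey.
  have E1 : 1%g = (t^-1 * s)%g.
    apply: dis; rewrite /tiling_centers /= ?SA ?SA1 //.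
    exists s; rewrite /tiling_shape SA SA1; split.
      by exists s => //; rewrite mulg1.
    by exists t => //; rewrite mulVKg.
  split; last by rewrite -[LHS](mulVKg t) -E1 mulg1.
  by apply: val_inj; move: SA1; rewrite -E1 SA => -[].
(* The tile containing 1 has center [s^-1] for some [s] in its shape. So [x] is left out only if the
   coloring is not locally constant at some [act (w * s^-1) x], which accounts for [#|D| * #|W|]
   translates. *)
- apply: (@dominated_le _ _ _ _ (\bigcup_(s : D) \bigcup_(w : W)
      act (val w * (val s)^-1)%g @^-1` [set x | ~ cst x]) _
      (fun v => \sum_(s : D) \sum_(w : W) N * `[< V v >])%N); last first.
  + apply: dominated_bigcup => s; apply: dominated_bigcup => w.
    exact: dominated_preimage.
  + by move=> v; rewrite !sum_nat_const -!cardfE !mulnA.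
  move=> x nx; have [[_ cover] inv] := Stile _ (zF x).
  have [g Cg [s sg E]] : (\bigcup_(g in tiling_centers (S (z x)))
      ((fun s => (s * g)%g) @` [set` tiling_shape (S (z x)) g])) 1%g.
    by rewrite cover.
  have invA := inv _ Cg.
  move: Cg sg invA; rewrite /tiling_centers /= /tiling_shape.
  case SA : (S (z x) g) => [A|//] _ /= sA invA.
  have sD : s \in D.
    have := valP A; rewrite fpowersetE => /fsubsetP; exact.
  have Eg : g = s^-1%g by rewrite -[RHS]mulg1 -E mulKg.
  apply: contrapT => nB; apply: nx.
  pose A' : I := exist _ A (asboolT invA).
  exists A' => //; exists s => //; exists (act g x); last first.
    by rewrite Eg (actVK act_homeo).
  split; first by rewrite Sz SA.
  move=> w; apply: contrapT => nc; apply: nB; exists [` sD]%fset => //.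
  by exists w => //=; rewrite -Eg (actM act_homeo).
Qed.

End castles.

(** * Invariant finite sets and visits of orbits *)

Lemma sum_seq_le_inj (T T' : eqType) (s : seq T) (t : seq T') (f : T -> T')
    (P : T' -> nat) :
  uniq s -> uniq t -> {in s &, injective f} -> {in s, forall x, f x \in t} ->
  (\sum_(x <- s) P (f x) <= \sum_(y <- t) P y)%N.
Proof.
elim: s t => [|x s IHs] t; first by rewrite big_nil.
move=> /andP[xs us] ut f_inj fst; rewrite big_cons.
have ft : f x \in t by apply: fst; rewrite mem_head.
rewrite (perm_big _ (perm_to_rem ft)) big_cons leq_add2l.
apply: IHs => //; first exact: rem_uniq.
- by move=> y y' ys y's; apply: f_inj; rewrite inE ?ys ?y's orbT.
- move=> y ys; rewrite mem_rem_uniq // inE fst ?inE ?ys ?orbT // andbT.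
  apply: contraNneq xs => fyx; rewrite -(f_inj y x) ?inE ?ys ?eqxx ?orbT //.
Qed.

Section group_fsets.
Context (R : realType) (G : groupType).
Implicit Types (E K L S Y : {fset G}).

Definition mulfs L Y : {fset G} := [fset (l * y)%g | l in L, y in Y]%fset.

Lemma mem_mulfs L Y l y : l \in L -> y \in Y -> (l * y)%g \in mulfs L Y.
Proof. by move=> lL yY; apply: in_imfset2. Qed.

Lemma mulfsP L Y g : reflect (exists2 l, l \in L & exists2 y, y \in Y & g = (l * y)%g)
  (g \in mulfs L Y).
Proof. exact: imfset2P. Qed.

Lemma invariant_fsetS K K' (eps eps' : R) S :
  {subset K' <= K} -> (eps <= eps')%R ->
  invariant_fset K eps S -> invariant_fset K' eps' S.
Proof.
move=> K'K le; rewrite /invariant_fset => inv.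
have sub : \bigcap_(g in [set` K]) ((fun h => (g * h)%g) @` [set` S]) `<=`
           \bigcap_(g in [set` K']) ((fun h => (g * h)%g) @` [set` S]).
  by move=> h hK g /= /K'K; exact: hK.
apply: (@le_lt_trans _ _ (((1 - eps) * #|` S|%:R)%:E)%R).
  by rewrite lee_fin ler_wpM2r ?ler0n // lerD2l lerN2.
apply: (lt_le_trans inv); rewrite /counting.
case: asboolP => [fin|nfin]; case: asboolP => [fin'|nfin'] //.
- rewrite lee_fin ler_nat; apply: fsubset_leq_card; apply/fsubsetP => h.
  by rewrite !in_fset_set // !inE; exact: sub.
- by rewrite leey.
- by exfalso; apply: nfin; exact: sub_finite_set fin'.
Qed.

(** As [K] contains 1, the intersection defining invariance lies in [S] and is finite. It serves as
    the core of [S] in the later estimates. *)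
Lemma invariant_core K (eps : R) S : 1%g \in K -> invariant_fset K eps S ->
  exists T : {fset G}, [/\ (T `<=` S)%fset,
    (#|` S|%:R - #|` T|%:R < eps * #|` S|%:R)%R &
    forall s g, s \in T -> g \in K -> (g^-1 * s)%g \in S].
Proof.
move=> K1 inv.
pose C := \bigcap_(g in [set` K]) ((fun h => (g * h)%g) @` [set` S]).
have CS : C `<=` [set` S].
  by move=> s /(_ 1%g K1)[t tS <-]; rewrite mul1g.
have Cfin : finite_set C := sub_finite_set CS (finite_fset S).
exists (fset_set C); split.
- by apply/fsubsetP => s; rewrite in_fset_set // inE => /CS.
- move: inv; rewrite /invariant_fset /counting asboolT // lte_fin -/C.
  lra.
- move=> s g; rewrite in_fset_set // inE => Cs gK.
  by have [t tS <-] := Cs g gK; rewrite mulKg.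
Qed.

Lemma invariant_fset_neq0 K (eps : R) S :
  1%g \in K -> invariant_fset K eps S -> (0 < #|` S|)%N.
Proof.
move=> K1 /(invariant_core K1)[T [TS ltS _]].
rewrite lt0n; apply/eqP => S0.
have := fsubset_leq_card TS; rewrite S0 leqn0 => /eqP T0.
by move: ltS; rewrite S0 T0 mulr0 subrr ltxx.
Qed.

(** With [E^-1] inside [K], left multiplication by [E] keeps the core in [S]. Fewer than
    [#|S| / (#|E| + 1)] elements remain, and they yield at most [#|S|] further products. *)
Lemma invariant_mulfs E : exists (K : {fset G}) (eps : R), (0 < eps)%R /\
  forall S, invariant_fset K eps S -> (#|` mulfs E S| <= 2 * #|` S|)%N.
Proof.
exists (1%g |` [fset g^-1%g | g in E])%fset, (#|` E|.+1%:R^-1)%R.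
split=> [|S inv]; first by rewrite invr_gt0 ltr0n.
set K := (_ |` _)%fset in inv.
have K1 : 1%g \in K by rewrite !inE eqxx.
have [T [TS ltT TK]] := invariant_core K1 inv.
have sub : {subset mulfs E S <= (S ++ [seq (g * s)%g | g <- E, s <- (S `\` T)%fset])}.
  move=> _ /mulfsP[g gE [s sS ->]]; rewrite mem_cat.
  have [sT|sT] := boolP (s \in T).
    rewrite -{1}[g]invgK TK //= /K !inE; apply/orP; right; exact: in_imfset.
  by rewrite allpairs_f ?orbT // !inE sT sS.
have := uniq_leq_size (fset_uniq _) sub.
rewrite size_cat size_allpairs => /leq_trans; apply.
rewrite mul2n -addnn leq_add2l cardfsDS // -(ler_nat R) natrM natrB; last first.
  exact: fsubset_leq_card.
move: ltT; rewrite mulrC ltr_pdivlMr ?ltr0n // -natr1 mulrDr mulr1 => ltT.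
have leTS : (#|` T|%:R <= #|` S|%:R :> R)%R by rewrite ler_nat fsubset_leq_card.
rewrite mulrC; lra.
Qed.

End group_fsets.

(** * Visits of orbits to dominated sets and to marker sets *)

Section visits.
Context (R : realType) (G : groupType) (X : topologicalType).
Context (act : G -> X -> X).
Hypothesis act_homeo : action_by_homeo act.

Definition visits (S : {fset G}) (x : X) (A : set X) : nat :=
  \sum_(s <- S) `[< A (act s x) >].

Lemma visits_le S x (A A' : set X) : A `<=` A' -> (visits S x A <= visits S x A')%N.
Proof.
move=> AA'; apply: leq_sum => s _; case: asboolP => // /AA' A's.
by rewrite asboolT.
Qed.

Lemma visitsU S x (A A' : set X) :
  (visits S x (A `|` A') <= visits S x A + visits S x A')%N.
Proof.
rewrite -big_split; apply: leq_sum => s _ /=.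
by case: asboolP => // -[] As; rewrite (asboolT As) // addnC.
Qed.

(** Double counting: if [act s x] lies in [P i], then [act (h i * s) x] lies in the translate of
    [P i] by [h i]. *)
Lemma dominated_visits (A V : set X) N : dominated act A (fun z => N * `[< V z >])%N ->
  exists H : {fset G}, forall S x, (visits S x A <= N * visits (mulfs H S) x V)%N.
Proof.
move=> [I [P [h [_ AP Pw]]]].
exists [fset h i | i in I]%fset => S x; set H := mulfs _ S.
apply: (@leq_trans (\sum_(s <- S) \sum_i `[< P i (act s x) >])).
  apply: leq_sum => s _; case: asboolP => // /AP[i _ Pi].
  by rewrite (bigD1 i) //= asboolT.
rewrite exchange_big /=.
apply: (@leq_trans (\sum_i \sum_(t <- H) `[< P i (act (h i)^-1%g (act t x)) >])).
  apply: leq_sum => i _.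
  have -> : (\sum_(s <- S) `[< P i (act s x) >] =
      \sum_(s <- S) `[< P i (act (h i)^-1%g (act (h i * s)%g x)) >])%N.
    by apply: eq_bigr => s _; rewrite (actM act_homeo) (actK act_homeo).
  apply: (@sum_seq_le_inj _ _ _ _ (fun s => h i * s)%g
    (fun t => `[< P i (act (h i)^-1%g (act t x)) >] : nat)).
  - exact: fset_uniq.
  - exact: fset_uniq.
  - by move=> s t _ _; exact: mulgI.
  - by move=> s sS; apply: mem_mulfs => //; apply: in_imfset.
rewrite exchange_big /= big_distrr /=; apply: leq_sum => t _; exact: Pw.
Qed.

(** By freeness the products [l * y], with [l] in [L] and [act y x] in [V], are pairwise
    distinct. *)
Lemma free_visits (L Y : {fset G}) (V : set X) x : free_set act L V ->
  (#|` L| * visits Y x V <= #|` mulfs L Y|)%N.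
Proof.
move=> freeV; pose Y' := [seq y <- Y | `[< V (act y x) >]].
have -> : visits Y x V = size Y'.
  by rewrite /Y' size_filter -sum1_count big_mkcond; apply: eq_bigr => y _; case: ifP.
rewrite -(size_allpairs (fun l y => (l * y)%g) L Y'); apply: uniq_leq_size.
  apply: allpairs_uniq; [exact: fset_uniq|exact/filter_uniq/fset_uniq|].
  move=> _ _ /allpairsP[[l y] /= [lL yY ->]] /allpairsP[[l' y'] /= [lL' yY' ->]] /= E.
  move: yY yY'; rewrite !mem_filter => /andP[/asboolP Vy _] /andP[/asboolP Vy' _].
  have ll : l = l'.
    apply: freeV => //=; exists (act (l * y)%g x); split.
      by exists (act y x) => //; rewrite (actM act_homeo).
    by rewrite E; exists (act y' x) => //; rewrite (actM act_homeo).
  by rewrite ll in E *; move/mulgI: E => ->.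
move=> _ /allpairsP[[l y] /= [lL + ->]]; rewrite mem_filter => /andP[_ yY].
exact: mem_mulfs.
Qed.

Lemma sparse_visits (A V : set X) N (L : {fset G}) :
  dominated act A (fun z => N * `[< V z >])%N -> free_set act L V ->
  exists (K : {fset G}) (eps : R), (0 < eps)%R /\
    forall S x, invariant_fset K eps S ->
      (#|` L| * visits S x A <= 2 * N * #|` S|)%N.
Proof.
move=> /dominated_visits[H HA] freeV.
have [K [eps [eps0 KS]]] := invariant_mulfs R (mulfs L H).
exists K, eps; split=> // S x /KS KSle.
apply: (@leq_trans (N * (#|` L| * visits (mulfs H S) x V))).
  by rewrite mulnCA leq_mul2l HA orbT.
rewrite (mulnC 2) -mulnA leq_mul2l; apply/orP; right.
apply: leq_trans (free_visits _ _ freeV) _; apply: leq_trans KSle.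
apply: fsubset_leq_card.
apply/fsubsetP => _ /mulfsP[l lL [_ /mulfsP[h hH [s sS ->]] ->]].
by rewrite mulgA; do 2?apply: mem_mulfs.
Qed.

(** The upper density is an infimum over finite sets, so one sufficiently invariant set bounds
    it. *)
Lemma sparse_upper_density (A V : set X) N (L : {fset G}) (eps : R) :
  amenable R G -> dominated act A (fun z => N * `[< V z >])%N ->
  free_set act L V -> (0 < eps)%R -> (2 * N%:R < eps * #|` L|%:R)%R ->
  (upper_density R act A < eps%:E)%E.
Proof.
move=> amG domA freeV eps0 Llarge.
have [K [d [d0 KA]]] := sparse_visits domA freeV.
have [S S0 invS] := amG K d d0.
have Spos : (0 < #|` S|%:R :> R)%R by rewrite ltr0n cardfs_gt0.
have Lpos : (0 < #|` L|%:R :> R)%R.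
  rewrite ltr0n lt0n; apply/eqP => L0; move: Llarge.
  by rewrite L0 mulr0 ltNge mulr_ge0 ?ler0n.
apply: (@le_lt_trans _ _ ((2 * N%:R / #|` L|%:R)%:E)%R); last first.
  by rewrite lte_fin ltr_pdivrMr.
apply: ge_ereal_inf; exists (ereal_sup [set ((#|` fset_set
    (A `&` (act^~ x @` [set` S])) |)%:R / (#|` S|)%:R)%:E%R | x in [set: X]]).
  by exists S.
apply: ge_ereal_sup => _ [x _ <-]; rewrite lee_fin.
rewrite ler_pdivrMr // mulrAC ler_pdivlMr // -!natrM ler_nat mulnC.
apply: leq_trans (KA S x invS); rewrite leq_mul2l; apply/orP; right.
have fin : finite_set (A `&` (act^~ x @` [set` S])).
  by apply: finite_setIr; exact: finite_image.
apply: (@leq_trans (size [seq act s x | s <- S & `[< A (act s x) >]])).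
  apply: uniq_leq_size => // y; rewrite in_fset_set // inE => -[Ay [s sS Ey]].
  apply/mapP; exists s => //; rewrite mem_filter sS andbT.
  by apply/asboolP; rewrite Ey.
rewrite size_map size_filter -sum1_count big_mkcond /visits.
by apply: leq_sum => s _; case: ifP.
Qed.

Hypotheses (X_hausdorff : hausdorff_space X) (X_compact : compact [set: X]).

Lemma marker_finite_cover (V : set X) : marker_set act V ->
  exists E : {fset G}, forall x, exists2 e, e \in E & V (act e x).
Proof.
move=> [oV VX].
have [||J [u uX]] := @compact_finite_cover X setT G (fun g => act g @^-1` V) X_compact.
- by move=> g; exact: open_act_preimage.
- move=> x _; have [g _ [y Vy Ey]] : (\bigcup_g act g @` V) x by rewrite VX.
  by exists g^-1%g => //; rewrite /= -Ey (actK act_homeo).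
exists [fset u j | j in J]%fset => x; have [j _ Vj] := uX x I.
by exists (u j) => //; apply: in_imfset.
Qed.

Lemma marker_many_visits (V : set X) N : infinite_set [set: G] -> marker_set act V ->
  exists L : {fset G}, forall x, (N <= visits L x V)%N.
Proof.
move=> infG /marker_finite_cover[E EV].
elim: N => [|N [L NL]]; first by exists fset0.
(* [E * l] meets [L] only for [l] in [E^-1 * L], a finite set. Any other [l] adds a fresh visit. *)
pose Bad : {fset G} := mulfs [fset e^-1%g | e in E]%fset L.
have [l [_ nl]] : [set: G] `\` [set` Bad] !=set0.
  by apply: infinite_setN0; exact: infinite_setD.
have dis : ~~ has (mem L) (mulfs E [fset l]%fset).
  apply/hasPn => g /mulfsP[e eE [k]]; rewrite inE => /eqP -> ->; apply/negP => gL.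
  apply: nl; rewrite /= -(mulKg e l).
  by apply: mem_mulfs => //; apply: in_imfset.
exists (L `|` mulfs E [fset l])%fset => x.
apply: leq_trans (@sum_seq_le_inj _ _ (L ++ mulfs E [fset l]%fset) _ id
  (fun g => `[< V (act g x) >] : nat) _ _ _ _).
- rewrite big_cat /= -addn1; apply: leq_add; first exact: NL.
  have [e eE Ve] := EV (act l x).
  have elE : (e * l)%g \in mulfs E [fset l]%fset by apply: mem_mulfs; rewrite ?inE.
  by rewrite (big_fsetD1 _ elE) /= asboolT // (actM act_homeo).
- by rewrite cat_uniq !fset_uniq dis.
- exact: fset_uniq.
- by [].
- by move=> g; rewrite mem_cat in_fsetU.
Qed.

(** Finitely many translates of [U] cover the space; the shrunken cover is moved back into [U]. *)
Lemma marker_closed_shrink (U : set X) : marker_set act U ->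
  exists (W C : set X), [/\ marker_set act W, closed C, W `<=` C & C `<=` U].
Proof.
move=> mU; have [oU _] := mU; have [E EU] := marker_finite_cover mU.
have [||W [oW WU XW]] := @closed_cover_shrink X X_hausdorff X_compact setT E
    (fun e => act (val e) @^-1` U) closedT.
- by move=> e; exact: open_act_preimage.
- by move=> x _; have [e eE Ue] := EU x; exists [` eE]%fset.
exists (\bigcup_(e : E) act (val e)^-1%g @^-1` W e),
  (\bigcup_(e : E) act (val e)^-1%g @^-1` closure (W e)); split.
- split; first by apply: bigcup_open => e _; exact: open_act_preimage.
  rewrite -subTset => x _; have [e _ We] := XW x I.
  exists (val e)^-1%g => //; exists (act (val e) x); last by rewrite (actK act_homeo).
  by exists e => //=; rewrite (actK act_homeo).
- by apply: closed_bigcup_fin => e _; apply: closed_act_preimage => //; exact: closed_closure.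
- by apply: subset_bigcup => e _ x /= Wx; exact: subset_closure.
- by move=> x [e _ /WU] /=; rewrite (actVK act_homeo).
Qed.

End visits.

(** * Invariant measures from finitely additive means *)

Section content_measure.
Context (R : realType) (X : topologicalType) (x0 : X) (m : set X -> R).
Hypotheses (X_hausdorff : hausdorff_space X) (X_compact : compact [set: X]).
Hypotheses (m_mono : forall A B, A `<=` B -> (m A <= m B)%R)
  (m_add : forall A B, A `&` B = set0 -> (m (A `|` B) = m A + m B)%R)
  (m_setT : m setT = 1%R).

Local Open Scope ereal_scope.

Definition inner_content (U : set X) : \bar R :=
  ereal_sup [set (m C)%:E | C in [set C | closed C /\ C `<=` U]].

(* [mu_ext] takes infima over countable covers by measurable sets; here every
   set is measurable, and the value [+oo] leaves only the open covers. *)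
Definition power_space := g_sigma_algebraType (@setT (set (pointed_at x0))).

Definition open_content (U : set power_space) : \bar R :=
  if `[< open (U : set X) >] then inner_content U else +oo.

Definition content_outer (A : set (pointed_at x0)) : \bar R :=
  mu_ext open_content (A : set power_space).

Lemma content_set0 : m set0 = 0%R.
Proof. have := @m_add set0 set0; rewrite setI0 setU0 => /(_ erefl); lra. Qed.

Lemma content_subadditive A B : (m (A `|` B) <= m A + m B)%R.
Proof.
have -> : A `|` B = A `|` (B `\` A) by rewrite setDE setUIr setUCr setIT.
by rewrite m_add ?setDIK // lerD2l m_mono // => x [].
Qed.

Lemma inner_content_ge0 U : 0 <= inner_content U.
Proof.
apply: ereal_sup_ubound; exists set0; last by rewrite content_set0.
by split; [exact: closed0|exact: sub0set].
Qed.

Lemma inner_content_ge (C U : set X) : closed C -> C `<=` U ->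
  (m C)%:E <= inner_content U.
Proof. by move=> cC CU; apply: ereal_sup_ubound; exists C. Qed.

Lemma inner_content_le U : inner_content U <= (m U)%:E.
Proof. by apply: ge_ereal_sup => _ [C [_ CU] <-]; rewrite lee_fin m_mono. Qed.

(** Compactness leaves finitely many [F k]. Shrinking them gives closed sets inside, to which finite
    subadditivity of [m] applies. *)
Lemma closed_content_le_series (C : set X) (F : nat -> set X) : closed C ->
  (forall k, open (F k)) -> C `<=` \bigcup_k F k ->
  (m C)%:E <= \sum_(k <oo) inner_content (F k).
Proof.
move=> cC oF CF.
have [J [u CJ]] := compact_finite_cover (closed_compact X_compact cC) oF CF.
pose n := (\max_j (u j)).+1.
have un j : (u j < n)%N by rewrite ltnS leq_bigmax.
have Cn : C `<=` \bigcup_(k : 'I_n) F k.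
  by move=> x /CJ[j _ Fx]; exists (Ordinal (un j)).
have [V [oV VF CV]] := closed_cover_shrink X_hausdorff X_compact cC
  (fun k : 'I_n => oF k) Cn.
apply: (@le_trans _ _ (\sum_(k < n) inner_content (F k))); last first.
  rewrite -(big_mkord xpredT (fun k => inner_content (F k))).
  by apply: nneseries_lim_ge => k _ _; exact: inner_content_ge0.
apply: (@le_trans _ _ (\sum_(k < n) (m (closure (V k)))%:E)); last first.
  by apply: lee_sum => k _; apply: inner_content_ge; [exact: closed_closure|exact: VF].
apply: (@le_trans _ _ (m (\big[setU/set0]_(k < n) closure (V k)))%:E).
  rewrite lee_fin m_mono // => x /CV[k _ Vx].
  by rewrite -bigcup_seq; exists k; [rewrite /= mem_index_enum|exact: subset_closure].
rewrite sumEFin lee_fin; apply: (big_ind2 (fun A r => m A <= r)%R) => //.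
  by rewrite content_set0.
move=> A a B b mA mB; apply: le_trans (content_subadditive A B) _.
exact: lerD.
Qed.

Lemma open_contentE U : open (U : set X) -> open_content U = inner_content U.
Proof. by move=> oU; rewrite /open_content asboolT. Qed.

Lemma open_content0 : open_content set0 = 0.
Proof.
rewrite open_contentE; last exact: open0.
apply/eqP; rewrite eq_le inner_content_ge0 andbT.
by apply: le_trans (inner_content_le _) _; rewrite content_set0.
Qed.

Lemma open_content_ge0 U : 0 <= open_content U.
Proof.
by rewrite /open_content; case: ifP => // _; exact: inner_content_ge0.
Qed.

HB.instance Definition _ := isOuterMeasure.Build R (pointed_at x0) content_outer
  (mu_ext0 open_content0 open_content_ge0) (mu_ext_ge0 open_content_ge0)
  (le_mu_ext open_content) (mu_ext_sigma_subadditive open_content_ge0).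

Lemma content_outer_closed (C : set X) : closed C -> (m C)%:E <= content_outer C.
Proof.
move=> cC; apply: le_ereal_inf_tmp => _ [F [_ CF] <-].
have [oF|] := pselect (forall k, open (F k : set X)).
  rewrite (eq_eseriesr (fun k _ => open_contentE (oF k))).
  exact: closed_content_le_series.
move=> /existsNP[k nF]; rewrite (eseries_pinfty (k := k)) ?leey //.
  by move=> n _; rewrite gt_eqF // (lt_le_trans _ (open_content_ge0 _)).
by rewrite /open_content asboolF.
Qed.

Lemma content_outer_open_le (U : set X) : open U ->
  content_outer U <= inner_content U.
Proof.
move=> oU; apply: ge_ereal_inf.
exists (\sum_(k <oo) open_content (if k is 0%N then U else set0)).
  exists (fun k => if k is 0%N then U else set0) => //; split=> [k|x Ux].
    exact: sub_sigma_algebra.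
  by exists 0%N.
rewrite nneseries_recl //; last by move=> *; exact: open_content_ge0.
rewrite eseries_cond /= eseries0 ?adde0 ?open_contentE // => -[//|k _ _].
exact: open_content0.
Qed.

(** It suffices to split each open member [F k] of a cover. A closed [C] inside both [F k] and [U]
    and a closed [C'] inside [F k] minus [C] are disjoint, so their contents add up within [F k];
    suprema over [C'] and then over [C] give the two terms. *)
Lemma caratheodory_open (U : set X) : open U ->
  (content_outer : set (pointed_at x0) -> \bar R).-caratheodory U.
Proof.
move=> oU; apply: le_caratheodory_measurable => E.
apply: le_ereal_inf_tmp => _ [F [_ EF] <-].
have [oF|/existsNP[k nF]] := pselect (forall k, open (F k : set X)); last first.
  rewrite (eseries_pinfty (k := k)) ?leey //.
    by move=> n _; rewrite gt_eqF // (lt_le_trans _ (open_content_ge0 _)).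
  by rewrite /open_content asboolF.
have step k : content_outer (F k `&` U) + content_outer (F k `&` ~` U) <=
    open_content (F k).
  rewrite open_contentE //.
  apply: (@le_trans _ _ (inner_content (F k `&` U) + content_outer (F k `&` ~` U))).
    by rewrite leeD2r //; apply: content_outer_open_le; exact: openI.
  have fin : content_outer (F k `&` ~` U) \is a fin_num.
    rewrite ge0_fin_numE ?outer_measure_ge0 //.
    apply: (@le_lt_trans _ _ (inner_content setT)).
      apply: le_trans (content_outer_open_le (@openT X)).
      by apply: le_outer_measure.
    by apply: le_lt_trans (inner_content_le _) _; rewrite ltry.
  rewrite -leeBrDr //; apply: ge_ereal_sup => _ [C [cC CFU] <-].
  rewrite leeBrDr //.
  apply: (@le_trans _ _ ((m C)%:E + inner_content (F k `&` ~` C))).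
    rewrite leeD2l //.
    apply: le_trans (content_outer_open_le (openI (oF k) (closed_openC cC))).
    apply: le_outer_measure => x [Fx nUx]; split=> //.
    by move=> /CFU[].
  rewrite addeC -leeBrDr //; apply: ge_ereal_sup => _ [C' [cC' C'F] <-].
  rewrite leeBrDr // -EFinD addrC -m_add.
    apply: inner_content_ge; first exact: closedU.
    by move=> x [/CFU[]|/C'F[]].
  by rewrite -subset0 => x [Cx /C'F[_]].
apply: (@le_trans _ _ (\sum_(k <oo)
    (content_outer (F k `&` U) + content_outer (F k `&` ~` U)))); last first.
  apply: lee_nneseries => k _ //.
  by rewrite adde_ge0 ?outer_measure_ge0.
rewrite nneseriesD; try by move=> *; exact: outer_measure_ge0.
apply: leeD.
- apply: le_trans (outer_measure_sigma_subadditive _ _).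
  by apply: le_outer_measure => x [/EF[k _ Fx] Ux]; exists k.
- apply: le_trans (outer_measure_sigma_subadditive _ _).
  by apply: le_outer_measure => x [/EF[k _ Fx] Ux]; exists k.
Qed.

Lemma borel_caratheodory (A : set (borel_space x0)) : measurable A ->
  (content_outer : set (pointed_at x0) -> \bar R).-caratheodory A.
Proof.
apply: smallest_sub; last exact: caratheodory_open.
split.
- exact: caratheodory_measurable_set0.
- by move=> B mB; rewrite setTD; exact: caratheodory_measurable_setC.
- exact: caratheodory_measurable_bigcup.
Qed.

Definition content_measure (A : set (borel_space x0)) : \bar R := content_outer A.

Let content_measure0 : content_measure set0 = 0.
Proof. exact: outer_measure0. Qed.

Let content_measure_ge0 A : 0 <= content_measure A.
Proof. exact: outer_measure_ge0. Qed.

Let content_measure_sigma_additive : semi_sigma_additive content_measure.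
Proof.
move=> F mF tF mUF.
apply: (@caratheodory_measure_sigma_additive _ _
  (content_outer : {outer_measure set (pointed_at x0) -> \bar R}%R) F) => //.
- by move=> k; exact: borel_caratheodory (mF k).
- exact: borel_caratheodory mUF.
Qed.

HB.instance Definition _ := isMeasure.Build _ (borel_space x0) R content_measure
  content_measure0 content_measure_ge0 content_measure_sigma_additive.

Let content_measure_setT : content_measure setT = 1.
Proof.
apply/eqP; rewrite eq_le; apply/andP; split.
  apply: le_trans (content_outer_open_le (@openT X)) _.
  by apply: le_trans (inner_content_le _) _; rewrite m_setT.
by rewrite -m_setT; apply: content_outer_closed; exact: closedT.
Qed.

HB.instance Definition _ := Measure_isProbability.Build _ _ _ content_measure
  content_measure_setT.

Lemma content_probability : exists mu : probability (borel_space x0) R,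
  mu = content_measure :> (set _ -> _).
Proof. by exists content_measure. Qed.

End content_measure.

Lemma ultra_cvg_bounded (R : realType) (T : Type) (F : set_system T) (u : T -> R) :
  UltraFilter F -> (forall t, (0 <= u t <= 1)%R) -> exists l : R, u t @[t --> F] --> l.
Proof.
move=> FU u01.
have FF := @ultra_proper _ F FU.
have [|l [_ lu]] := @segment_compact R 0%R 1%R (u t @[t --> F]) _.
  by apply: nearW => t; rewrite /= in_itv /=.
exists l => N lN; have [//|FnN] := in_ultra_setVsetC (u @^-1` N) FU.
by have [r []] := lu (~` N) N FnN lN.
Qed.

(** * Limits of orbit averages *)

Section invariant_means.
Context (R : realType) (G : groupType) (X : topologicalType).
Context (act : G -> X -> X).
Hypothesis act_homeo : action_by_homeo act.

Lemma content_outer_preimage (x0 : X) (m : set X -> R) g (A : set X) :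
  (forall B C, B `&` C = set0 -> m (B `|` C) = m B + m C)%R ->
  (forall h B, m (act h @^-1` B) = m B) ->
  (content_outer (x0 := x0) m (act g @^-1` A) <= content_outer (x0 := x0) m A)%E.
Proof.
move=> m_add m_inv.
have inner_inv U : (inner_content m (act g @^-1` U) <= inner_content m U)%E.
  apply: ge_ereal_sup => _ [C [cC CU] <-]; rewrite -(m_inv g^-1%g).
  apply: inner_content_ge; first exact: closed_act_preimage.
  by move=> x /CU; rewrite /= (actVK act_homeo).
apply: le_ereal_inf_tmp => _ [F [_ AF] <-].
apply: ge_ereal_inf; exists (\sum_(k <oo)
    open_content (x0 := x0) m (act g @^-1` (F k : set X)))%E.
  exists (fun k => act g @^-1` (F k : set X)) => //; split=> [k|x /AF[k _ Fk]].
    exact: sub_sigma_algebra.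
  by exists k.
apply: lee_nneseries => k _; first by move=> _; exact: open_content_ge0.
rewrite /open_content; case: asboolP => [oF|]; case: asboolP => [oF'|nF] //.
- by rewrite leey.
- move=> nF'; exfalso; apply: nF'; exact: open_act_preimage.
Qed.

Lemma content_probability_invariant (x0 : X) (m : set X -> R)
    (mu : probability (borel_space x0) R) :
  (forall B C, B `&` C = set0 -> m (B `|` C) = m B + m C)%R ->
  (forall h B, m (act h @^-1` B) = m B) ->
  mu = content_measure (x0 := x0) m :> (set _ -> _) -> invariant_measure act mu.
Proof.
move=> m_add m_inv muE g A _; rewrite muE /content_measure (image_act act_homeo).
apply/eqP; rewrite eq_le content_outer_preimage //=.
have E : A = act g @^-1` (act g^-1%g @^-1` A).
  by apply/seteqP; split=> x /=; rewrite (actK act_homeo).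
by rewrite [in X in (X <= _)%E]E content_outer_preimage.
Qed.

Lemma visits_setT S x : visits act S x setT = #|` S|.
Proof.
rewrite card_fset_sum1; apply: eq_bigr => s _; by rewrite asboolT.
Qed.

Lemma visits_disjointU S x (A B : set X) : A `&` B = set0 ->
  visits act S x (A `|` B) = (visits act S x A + visits act S x B)%N.
Proof.
move=> AB; rewrite -big_split; apply: eq_bigr => s _ /=.
case: (asboolP (A _)) => As; case: (asboolP (B _)) => Bs.
- by have : (A `&` B) (act s x) by []; rewrite AB.
- by rewrite asboolT //; left.
- by rewrite asboolT //; right.
- by rewrite asboolF // => -[].
Qed.

(** Since [g^-1] is in [K], multiplication by [g] maps the core injectively into [S]; the rest of
    [S] has fewer than [eps * #|S|] elements. *)
Lemma visits_preimage K (eps : R) S x g (A : set X) :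
  1%g \in K -> g^-1%g \in K -> invariant_fset K eps S ->
  ((visits act S x (act g @^-1` A))%:R <= (visits act S x A)%:R + eps * #|` S|%:R)%R.
Proof.
move=> K1 gK /(invariant_core K1)[T [TS ltT TK]].
have le1 : (visits act S x (act g @^-1` A) <=
    visits act T x (act g @^-1` A) + (#|` S| - #|` T|))%N.
  apply: (@leq_trans (\sum_(s <- T ++ (S `\` T)%fset) `[< A (act g (act s x)) >])).
    apply: (@sum_seq_le_inj _ _ _ _ id (fun s => `[< A (act g (act s x)) >] : nat)).
    - exact: fset_uniq.
    - rewrite cat_uniq !fset_uniq andbT /=; apply/hasPn => s.
      by rewrite in_fsetD => /andP[].
    - by [].
    - by move=> s sS; rewrite mem_cat in_fsetD sS andbT orbN.
  rewrite big_cat leq_add2l -cardfsDS // card_fset_sum1.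
  by apply: leq_sum => s _; case: asboolP.
have le2 : (visits act T x (act g @^-1` A) <= visits act S x A)%N.
  rewrite /visits.
  have -> : (\sum_(s <- T) `[< (act g @^-1` A) (act s x) >] =
             \sum_(s <- T) `[< A (act (g * s)%g x) >])%N.
    by apply: eq_bigr => s _; rewrite (actM act_homeo).
  apply: (@sum_seq_le_inj _ _ _ _ (fun s => g * s)%g
    (fun s => `[< A (act s x) >] : nat)).
  - exact: fset_uniq.
  - exact: fset_uniq.
  - by move=> s t _ _; exact: mulgI.
  - by move=> s sT; rewrite -[g]invgK TK.
have leTS : (#|` T| <= #|` S|)%N by exact: fsubset_leq_card.
have : (visits act S x (act g @^-1` A) + #|` T| <= visits act S x A + #|` S|)%N.
  by lia.
rewrite -(ler_nat R) !natrD; lra.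
Qed.

Lemma exhausting_fsets : countable [set: G] ->
  exists K : nat -> {fset G}, (forall n, 1%g \in K n) /\
    forall g, \forall n \near \oo, g \in K n.
Proof.
move=> /countable_injP[f f_inj].
have fin n : finite_set [set g | (f g <= n)%N].
  apply: (finite_preimage (B := `I_n.+1) (f := f)) => //.
  move=> g h _ _ fgh; apply: f_inj fgh; exact: mem_set.
exists (fun n => 1%g |` fset_set [set g | (f g <= n)%N])%fset; split.
  by move=> n; rewrite !inE eqxx.
move=> g; near=> n; apply/fset1UP; right.
rewrite in_fset_set //; apply: mem_set; near: n; exact: nbhs_infty_ge.
Unshelve. all: by end_near. Qed.

Hypotheses (X_hausdorff : hausdorff_space X) (X_compact : compact [set: X]).

(* Otherwise the orbit averages along ever more invariant sets have, along an
   ultrafilter, a finitely additive limit [m] on all sets with [m B <= m A]; the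
   outer measure it induces on open sets, from inside by closed sets, restricts to
   an invariant Borel probability measure with [m A <= mu A] and [mu B <= m B]. *)
Lemma visits_gap (A B : set X) : countable [set: G] -> closed A -> open B ->
  (forall (x0 : X) (mu : probability (borel_space x0) R),
     invariant_measure act mu -> (mu A < mu B)%E) ->
  exists (K : {fset G}) (eps : R), (0 < eps)%R /\
    forall S x, invariant_fset K eps S ->
      ((visits act S x A)%:R + eps * #|` S|%:R <= (visits act S x B)%:R :> R)%R.
Proof.
move=> cG cA oB ltAB; apply: contrapT => nogap.
have [K [K1 Kg]] := exhausting_fsets cG.
have /choice[S /choice[x Sx]] : forall n, exists (S : {fset G}) (x : X),
    invariant_fset (K n) (n.+1%:R^-1 : R)%R S /\
    ((visits act S x B)%:R < (visits act S x A)%:R + n.+1%:R^-1 * #|` S|%:R :> R)%R.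
  move=> n; apply: contrapT => none; apply: nogap.
  exists (K n), (n.+1%:R^-1)%R; split; first by rewrite invr_gt0 ltr0n.
  move=> S x inv; rewrite leNgt; apply/negP => lt; apply: none.
  by exists S, x.
have Spos n : (0 < #|` S n|%:R :> R)%R.
  by have [inv _] := Sx n; rewrite ltr0n; exact: invariant_fset_neq0 (K1 n) inv.
have [F [FU F_oo]] := ultraFilterLemma (F := \oo) _.
pose a (E : set X) n : R := ((visits act (S n) (x n) E)%:R / #|` S n|%:R)%R.
have a_bound E n : (0 <= a E n <= 1)%R.
  rewrite /a divr_ge0 ?ler0n //= ler_pdivrMr // mul1r ler_nat -(visits_setT _ (x n)).
  by apply: visits_le; exact: subsetT.
have /choice[m am] : forall E, exists l : R, a E n @[n --> F] --> l.
  by move=> E; exact: ultra_cvg_bounded.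
have FF := @ultra_proper _ F FU.
(* The defect of invariance and the failing gap both have size [1 / (n + 1)], so one comparison of
   limits serves monotonicity, invariance and [m B <= m A]. *)
have m_le E E' : (\forall n \near \oo, (a E n <= a E' n + n.+1%:R^-1)%R) -> (m E <= m E')%R.
  move=> leE.
  have harm : (n.+1%:R^-1 : R)%R @[n --> F] --> (0%R : R).
    by apply: (cvg_trans _ (@cvg_harmonic R)); exact: cvg_app.
  have aE' : (a E' n + n.+1%:R^-1)%R @[n --> F] --> m E'.
    by rewrite -[m E']addr0; exact: cvgD.
  by apply: (ler_cvg_to (am E) aE'); exact: F_oo.
have m_mono E E' : E `<=` E' -> (m E <= m E')%R.
  move=> EE'; apply: m_le; apply: nearW => n.
  rewrite (@le_trans _ _ (a E' n)) // ?lerDl ?invr_ge0 ?ler0n //.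
  by rewrite ler_wpM2r ?invr_ge0 ?ler0n // ler_nat visits_le.
have m_add E E' : E `&` E' = set0 -> (m (E `|` E') = m E + m E')%R.
  move=> EE'; have aEE' : (a E n + a E' n)%R @[n --> F] --> (m E + m E')%R by exact: cvgD.
  apply: (cvg_unique _ (am (E `|` E'))) => //.
  apply: cvg_trans aEE'; apply: near_eq_cvg; apply: nearW => n.
  by rewrite /= /a visits_disjointU // natrD mulrDl.
have m_setT : m setT = 1%R.
  apply: (cvg_unique _ (am setT)) => //.
  have -> : a setT = (fun=> 1%R).
    by apply/funext => n; rewrite /a visits_setT divff // gt_eqF.
  exact: cvg_cst.
have m_inv_le g E : (m (act g @^-1` E) <= m E)%R.
  apply: m_le; near=> n.
  have [inv _] := Sx n.
  have gK : g^-1%g \in K n by near: n; exact: Kg.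
  have := visits_preimage (x n) E (K1 n) gK inv.
  rewrite /a ler_pdivrMr // mulrDl divfK ?gt_eqF //.
have m_inv g E : m (act g @^-1` E) = m E.
  apply/eqP; rewrite eq_le m_inv_le /=.
  have {1}-> : E = act g^-1%g @^-1` (act g @^-1` E).
    by apply/seteqP; split=> y /=; rewrite (actVK act_homeo).
  exact: m_inv_le.
have mBA : (m B <= m A)%R.
  apply: m_le; apply: nearW => n; have [_ lt] := Sx n.
  by rewrite /a ler_pdivrMr // mulrDl divfK ?gt_eqF // ltW.
have [mu muE] := content_probability (x 0%N) X_hausdorff X_compact m_mono m_add m_setT.
have := ltAB _ _ (content_probability_invariant m_add m_inv muE).
rewrite ltNge => /negP; apply; rewrite muE.
apply: le_trans (content_outer_open_le _ m_mono m_add oB) _.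
apply: le_trans (inner_content_le m_mono _) _.
apply: le_trans (content_outer_closed _ X_hausdorff X_compact m_mono m_add cA).
by rewrite lee_fin.
Unshelve. all: by end_near. Qed.

End invariant_means.

(** * Rokhlin property and comparison *)

Section main.
Context (R : realType) (G : groupType) (X : topologicalType).
Context (act : G -> X -> X).
Hypotheses (G_countable : countable [set: G]) (G_infinite : infinite_set [set: G]).
Hypotheses (G_amenable : amenable R G)
  (G_local_tiling : has_local_tiling_algorithm R G).
Hypotheses (X_hausdorff : hausdorff_space X) (X_compact : compact [set: X]).
Hypotheses (act_homeo : action_by_homeo act) (act_free : free_action act).
Hypothesis act_FCSB : FCSB act.

Lemma large_free_marker (N : R) : exists (L : {fset G}) (V : set X),
  [/\ (N < #|` L|%:R)%R, free_set act L V & marker_set act V].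
Proof.
have [L _ NL] := infinite_set_fset (Num.Def.archi_bound `|N|) G_infinite.
have [V freeV mV] := act_FCSB.1 L.
exists L, V; split=> //; apply: le_lt_trans (ler_norm N) _.
by apply: lt_le_trans (archi_boundP (normr_ge0 _)) _; rewrite ler_nat.
Qed.

Lemma FCSB_URP : URP R act.
Proof.
move=> K eps eps0.
have [N castleN] := FCSB_castle act_homeo act_free X_hausdorff X_compact K
  G_countable G_local_tiling act_FCSB eps0.
(* [N] is known before [V], so [V] can be chosen free for more than [2 * N / eps] elements, which
   pushes the density of the remainder below [eps]. *)
have [L [V [Llarge freeV mV]]] := large_free_marker (2 * N%:R / eps)%R.
have [I [S [B [oB invS dis dom]]]] := castleN V mV.
pose t (i : 'I_#|I|) : I := enum_val i.
exists #|I|, (fun i => S (t i)), (fun i => B (t i)); split.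
- split=> [i|i j _ _ [x [[s sS [y By <-]] [u uS [z Bz E]]]]].
    split; first exact: oB.
    move=> s u sS uS [x [[y By <-] [z Bz E]]].
    by have [] := dis _ _ _ _ _ _ sS uS By Bz (esym E).
  have [ij _] := dis _ _ _ _ _ _ sS uS By Bz (esym E).
  exact: enum_val_inj ij.
- by move=> i; exact: invS.
- have -> : \bigcup_(i in [set: 'I_#|I|]) tower act (S (t i)) (B (t i)) =
            \bigcup_i tower act (S i) (B i).
    apply/seteqP; split=> x [i _ Ti]; first by exists (t i).
    by exists (enum_rank i) => //; rewrite /t enum_rankK.
  apply: (sparse_upper_density act_homeo G_amenable dom freeV eps0).
  by rewrite [X in (_ < X)%R]mulrC -ltr_pdivrMr.
Qed.

Lemma invariant_meeting_marker (B : set X) (K : {fset G}) (eps : R) : (0 < eps)%R ->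
  open B -> (forall S x, invariant_fset K eps S -> S != fset0 ->
    (0 < visits act S x B)%N) -> marker_set act B.
Proof.
move=> eps0 oB pos; split=> //; rewrite -subTset => x _.
have [S S0 inv] := G_amenable K eps0.
apply: contrapT => nB; have := pos S x inv S0.
rewrite /visits big1_seq // => s _; rewrite asboolF // => Bs; apply: nB.
by exists s^-1%g => //; exists (act s x) => //; rewrite (actK act_homeo).
Qed.

(* Most of [A] is matched inside the towers of a castle with the part of [B]
   outside the closed set [C']; the rest is dominated by [N] copies of a sparse
   marker set [V], which fit into the marker set [V'] reserved inside [B]. *)
Lemma FCSB_comparison : comparison R act.
Proof.
move=> A B cA oB ltAB.
have [K [eps [eps0 gap]]] := visits_gap act_homeo X_hausdorff X_compact
  G_countable cA oB ltAB.
have mB : marker_set act B.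
  apply: (invariant_meeting_marker eps0 oB (K := K)) => S x inv S0.
  rewrite -(ltr_nat R); apply: lt_le_trans (gap S x inv).
  by rewrite ltr_wpDl ?ler0n // mulr_gt0 ?ltr0n ?cardfs_gt0.
have [E EB] := marker_finite_cover act_homeo X_compact mB.
(* [C'] is dominated by [#|E|] copies of [U]; with this size of [L1] its visits use up at most the
   gap [eps * #|S|]. *)
have [L1 [U [L1large freeU mU]]] := large_free_marker (2 * #|` E|%:R / eps)%R.
have [W [C [mW cC WC CU]]] := marker_closed_shrink act_homeo X_hausdorff X_compact mU.
pose C' : set X := \bigcup_(e : E) act (val e)^-1%g @^-1` C.
(* Each point of [W] is moved into [B] by some element of [E], so that [V'] is again a marker set.
   It lies in the closed set [C'], whose removal leaves [B] open. *)
pose V' : set X := B `&` \bigcup_(e : E) act (val e)^-1%g @^-1` W.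
have cC' : closed C'.
  by apply: closed_bigcup_fin => e _; exact: closed_act_preimage.
have V'C' : V' `<=` C' by move=> x [_ [e _ /WC]]; exists e.
have mV' : marker_set act V'.
  split.
    apply: openI => //; apply: bigcup_open => e _; apply: open_act_preimage => //.
    by case: mW.
  rewrite -subTset => x _; have [_ WX] := mW.
  have [g _ [y Wy <-]] : (\bigcup_g act g @` W) x by rewrite WX.
  have [e eE Be] := EB y; exists (g * e^-1)%g => //; exists (act e y).
    by split=> //; exists [` eE]%fset => //=; rewrite (actK act_homeo).
  by rewrite -(actM act_homeo) mulgVK.
have domC' : dominated act C' (fun z => #|` E| * `[< U z >])%N.
  apply: (@dominated_le _ _ _ _ (\bigcup_(e : E) act (val e)^-1%g @^-1` U) _
    (fun z => \sum_(e : E) `[< U z >])%N).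
  - by apply: subset_bigcup => e _ x /CU.
  - by move=> z; rewrite sum_nat_const cardfE.
  - apply: dominated_bigcup => e; apply: dominated_preimage => //.
    by apply: dominated_open => //; case: mU.
have [K2 [eps2 [eps20 sparse]]] := sparse_visits R act_homeo domC' freeU.
have gap' S x : invariant_fset (K `|` K2)%fset (Num.min eps eps2) S ->
    (visits act S x A <= visits act S x (B `\` C'))%N.
  move=> inv.
  have inv1 : invariant_fset K eps S.
    apply: invariant_fsetS inv; last by rewrite ge_min lexx.
    by move=> g gK; rewrite inE gK.
  have inv2 : invariant_fset K2 eps2 S.
    apply: invariant_fsetS inv; last by rewrite ge_min lexx orbT.
    by move=> g gK; rewrite inE gK orbT.
  have gapA := gap S x inv1; have := sparse S x inv2.
  have leB : (visits act S x B <= visits act S x (B `\` C') + visits act S x C')%N.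
    apply: leq_trans (visitsU _ _ _ _ _); apply: visits_le => y By.
    by have [C'y|nC'y] := pselect (C' y); [right|left].
  move: leB; rewrite -!(ler_nat R) natrD !natrM => leB leC.
  have L1pos : (0 < #|` L1|%:R :> R)%R.
    by apply: le_lt_trans L1large; rewrite divr_ge0 ?mulr_ge0 ?ler0n ?ltW.
  have : ((visits act S x C')%:R <= eps * #|` S|%:R :> R)%R.
    rewrite -(ler_pM2l L1pos); apply: le_trans leC _.
    rewrite mulrA ler_wpM2r ?ler0n //; apply: ltW; move: L1large.
    by rewrite ltr_pdivrMr.
  lra.
have eps30 : (0 < Num.min eps eps2)%R by rewrite lt_min eps0.
(* The choices depend on each other in this order: [N], then [L] with at least [N] visits to [V']
   from every point, then an [L]-free marker set [V], then the castle. *)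
have [N castleN] := FCSB_castle act_homeo act_free X_hausdorff X_compact
  (K `|` K2)%fset G_countable G_local_tiling act_FCSB eps30.
have [L LV'] := marker_many_visits act_homeo X_compact N G_infinite mV'.
have [V freeV mV] := act_FCSB.1 L.
have [I [S [D [oD invS dis [J [P [h [oP remP Pw]]]]]]]] := castleN V mV.
pose T := {i : I & S i}.
(* The sources are the tower levels, moved down to their bases, and the pieces of the remainder,
   moved into [V]. The targets are the levels within [B] minus [C'], seen from the bases, and the
   visits to [V'] along [L], seen from [V]. *)
apply: (@transport_subequivalent G X act act_homeo X_hausdorff X_compact A B
  (T + J)%type (T + L)%type
  (fun k => match k with
    | inl u => act (val (tagged u))^-1%g @^-1` D (tag u) | inr j => P j end)
  (fun k => match k with inl u => (val (tagged u))^-1%g | inr j => h j end)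
  (fun k => match k with
    | inl u => D (tag u) `&` act (val (tagged u)) @^-1` (B `\` C')
    | inr l => V `&` act (val l) @^-1` V' end)
  (fun k => match k with inl u => val (tagged u) | inr l => val l end)) => //.
- by move=> [u|j]; [exact: open_act_preimage|exact: oP].
- move=> x _; have [[i _ [s sS [y Dy <-]]]|nT] :=
      pselect ((\bigcup_i tower act (S i) (D i)) x).
    exists (inl (Tagged (fun i => S i) [` sS]%fset)) => //=.
    by rewrite (actK act_homeo).
  by have [j _ Pj] := remP x nT; exists (inr j).
- move=> [u|l]; first apply: openI => //; last apply: openI; last 2 first.
  + by case: mV.
  + by apply: open_act_preimage => //; case: mV'.
  + apply: open_act_preimage => //; rewrite setDE.
    by apply: openI => //; exact: closed_openC.
- by move=> [u|l] y /= [_ []].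
- move=> [[i s]|l] [[j u]|l'] y z /=.
  + move=> [Dy _] [Dz _] /(dis _ _ _ _ _ _ (valP s) (valP u) Dy Dz)[ij].
    by subst j => /val_inj ->.
  + by move=> [_ [_ nC]] [_ /V'C' C'z] E'; exfalso; apply: nC; rewrite /= E'.
  + by move=> [_ /V'C' C'y] [_ [_ nC]] E'; exfalso; apply: nC; rewrite /= -E'.
  (* Here freeness of [V] for [L] keeps the targets in [V'] apart. *)
  + move=> [Vy _] [Vz _] E'; congr inr; apply: val_inj; apply: freeV => //=.
    by exists (act (val l) y); split; [exists y|exists z].
(* The counts are compared separately: over a base by the gap along the shape, over [V] by the [N]
   visits along [L]. *)
- move=> y; rewrite !big_sumType /=; apply: leq_add.
  + rewrite -!(sig_big_dep (fun=> true) (fun _ _ => true)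
      (fun i (s : S i) => `[< (A `&` act (val s)^-1%g @^-1` D i)
         (act (val s)^-1^-1%g y) >] : nat)).
    rewrite -(sig_big_dep (fun=> true) (fun _ _ => true)
      (fun i (s : S i) => `[< (D i `&` act (val s) @^-1` (B `\` C')) y >] : nat)) /=.
    apply: leq_sum => i _; have [Dy|nDy] := pselect (D i y); last first.
      rewrite big1 // => s _; rewrite asboolF // invgK => -[_].
      by rewrite /= (actK act_homeo).
    apply: (@leq_trans (visits act (S i) y A)).
      rewrite /visits big_seq_fsetE /=; apply: leq_sum => s _.
      by rewrite invgK; case: asboolP => // -[As _]; rewrite asboolT.
    apply: leq_trans (gap' _ _ (invS i)) _.
    rewrite /visits big_seq_fsetE /=; apply: leq_sum => s _.
    by case: asboolP => // BC; rewrite asboolT.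
  + apply: (@leq_trans (\sum_j `[< P j (act (h j)^-1%g y) >])).
      by apply: leq_sum => j _; case: asboolP => // -[_ Pj]; rewrite asboolT.
    apply: leq_trans (Pw y) _; have [Vy|nVy] := pselect (V y); last first.
      by rewrite asboolF // muln0.
    rewrite asboolT // muln1; apply: leq_trans (LV' y) _.
    rewrite /visits big_seq_fsetE /=; apply: leq_sum => l _.
    by case: asboolP => // V'l; rewrite asboolT.
Qed.

End main.

Theorem theorem5p13 (R : realType) (G : groupType) (X : topologicalType)
    (act : G -> X -> X)
    (G_countable : countable [set: G]) (G_infinite : infinite_set [set: G])
    (G_amenable : amenable R G)
    (G_local_tiling : has_local_tiling_algorithm R G)
    (X_compact : compact [set: X]) (X_metrizable : metrizable R X)
    (act_homeo : action_by_homeo act) (act_free : free_action act) :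
  FCSB act -> URPC R act.
Proof.
have X_hausdorff := metrizable_hausdorff X_metrizable.
by move=> act_FCSB; split; [exact: FCSB_URP|exact: FCSB_comparison].
Qed.
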